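(* Suppose that $k\in\mathbb{N}_0\cup\{\infty\}$ and $K$ is a closed subset of $\mathbb{H}\cong\mathbb{R}^4$. Let $L:\mathbb{H}^k[q^*,q]\to\mathbb{H}$ be an $\mathbb{H}$-linear functional. Then the following statements are equivalent: (i) $L$ is $K$-positive, that is, $L(f)\ge 0$ for all $f\in E^k(K)_+$. (ii) $L$ is weakly $K$-positive, that is, for each $f\in E^k(K)_+$ there exists an $h\in E^k(K)_+$ such that $L(f+\varepsilon h)\ge 0$ for all $\varepsilon>0$. (iii) $L$ is a $K$-moment functional on $\mathbb{H}^k[q^*,q]$, that is, there exists a Radon measure $\mu$ on $\mathbb{H}$ such that $\mathrm{supp}\,\mu\subseteq K$ and $$L(f)=\int_{\mathbb{H}}f(q)\,d\mu(q)\quad\text{for all } f\in\mathbb{H}^k[q^*,q].$$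
   Context: $\mathbb{H}$ is the algebra of quaternions $q=x_0+x_1\mathrm{i}+x_2\mathrm{j}+x_3\mathrm{k}$, identified with $(x_0,x_1,x_2,x_3)\in\mathbb{R}^4$, with conjugation $q^*=x_0-x_1\mathrm{i}-x_2\mathrm{j}-x_3\mathrm{k}$. All polynomials are regarded as continuous $\mathbb{H}$-valued functions on $\mathbb{H}$, with pointwise operations. Let $\Sigma=\{1,\mathrm{i},\mathrm{j},\mathrm{k}\}$; for a set $F$, $\mathrm{span}_{\mathbb{H}}F$ is the set of finite sums of elements $afb$ with $a,b\in\mathbb{H}$, $f\in F$. For $k\in\mathbb{N}_0$, $$\mathbb{H}^k[q^*,q]=\mathrm{span}_{\mathbb{H}}\{(q^* )^{m_0}q^{n_0}\sigma_1(q^* )^{m_1}q^{n_1}\cdots\sigma_k(q^* )^{m_k}q^{n_k}: m_0,n_0,\dots,m_k,n_k\in\mathbb{N}_0,\ \sigma_1,\dots,\sigma_k\in\Sigma\}$$ (for $k=0$ this is the span of the elements $(q^* )^{m}q^{n}$), and $\mathbb{H}^\infty[q^*,q]=\bigcup_{k=0}^\infty\mathbb{H}^k[q^*,q]$. For $k\in\mathbb{N}_0$, $$E^k(K)_+:=\Big\{f\in\sum_{\alpha\in\mathbb{N}_0^3,|\alpha|\le k+1}x_1^{\alpha_1}x_2^{\alpha_2}x_3^{\alpha_3}\,\mathbb{R}[x_0,x_1^2+x_2^2+x_3^2]: f(x)\ge 0\text{ for } x\in K\Big\},$$ where $|\alpha|=\alpha_1+\alpha_2+\alpha_3$, and $E^\infty(K)_+:=\{f\in\mathbb{R}[x_0,x_1,x_2,x_3]: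 f(x)\ge 0\text{ for } x\in K\}$. (These are sets of elements of $\mathbb{H}^k[q^*,q]$.) An $\mathbb{H}$-linear functional is a map $L$ with $L(afb+cgd)=aL(f)b+cL(g)d$ for all $f,g$ in the space and $a,b,c,d\in\mathbb{H}$. Radon measures are positive, and integral formulas include integrability. For a quaternion $p$, ''$p\ge0$'' means that $p$ is real and nonnegative. *)

(* Defs.v *)
From HB Require Import structures.
From mathcomp Require Import all_boot all_order all_algebra.
From mathcomp Require Import all_classical all_reals all_analysis.
From mathcomp Require Export -(notations) mpoly.
From mathcomp Require Import ring.

Set Implicit Arguments.
Unset Strict Implicit.
Unset Printing Implicit Defensive.

Import Order.TTheory GRing.Theory Num.Theory.
Import numFieldNormedType.Exports.

Local Open Scope classical_set_scope.
Local Open Scope ring_scope.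

(** Quaternions. [x0 + x1 i + x2 j + x3 k] is the row vector
    [(x0, x1, x2, x3)]; the additive group and the topology are those of
    ['rV[R]_4], and the sigma-algebra is the Borel one. *)

Definition quat (R : realType) : Type := 'rV[R]_4.

HB.instance Definition _ (R : realType) := Choice.on (quat R).
HB.instance Definition _ (R : realType) :=
  GRing.Zmodule.copy (quat R) 'rV[R]_4.
HB.instance Definition _ (R : realType) :=
  PointedTopological.copy (quat R) 'rV[R]_4.
HB.instance Definition _ (R : realType) :=
  Measurable.copy (quat R) (g_sigma_algebraType (@open (quat R))).

Section QuatRing.
Context {R : realType}.
Implicit Types p q r : quat R.

Definition mkquat (a b c d : R) : quat R :=
  \row_(i < 4) nth 0 [:: a; b; c; d] i.

Definition qcoord (i : 'I_4) q : R := (q : 'rV[R]_4) ord0 i.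

Definition q0 q : R := qcoord (@Ordinal 4 0 isT) q.
Definition q1 q : R := qcoord (@Ordinal 4 1 isT) q.
Definition q2 q : R := qcoord (@Ordinal 4 2 isT) q.
Definition q3 q : R := qcoord (@Ordinal 4 3 isT) q.

Definition qone : quat R := mkquat 1 0 0 0.

Definition qmul p q : quat R := mkquat
  (q0 p * q0 q - q1 p * q1 q - q2 p * q2 q - q3 p * q3 q)
  (q0 p * q1 q + q1 p * q0 q + q2 p * q3 q - q3 p * q2 q)
  (q0 p * q2 q - q1 p * q3 q + q2 p * q0 q + q3 p * q1 q)
  (q0 p * q3 q + q1 p * q2 q - q2 p * q1 q + q3 p * q0 q).

Lemma quatP p q :
  q0 p = q0 q -> q1 p = q1 q -> q2 p = q2 q -> q3 p = q3 q -> p = q.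
Proof.
move=> h0 h1 h2 h3; apply/rowP => -[[|[|[|[|//]]]] hi].
- by have := h0; rewrite /q0 /qcoord (bool_irrelevance hi isT).
- by have := h1; rewrite /q1 /qcoord (bool_irrelevance hi isT).
- by have := h2; rewrite /q2 /qcoord (bool_irrelevance hi isT).
- by have := h3; rewrite /q3 /qcoord (bool_irrelevance hi isT).
Qed.

Lemma q0E a b c d : q0 (mkquat a b c d) = a.
Proof. by rewrite /q0 /qcoord mxE. Qed.
Lemma q1E a b c d : q1 (mkquat a b c d) = b.
Proof. by rewrite /q1 /qcoord mxE. Qed.
Lemma q2E a b c d : q2 (mkquat a b c d) = c.
Proof. by rewrite /q2 /qcoord mxE. Qed.
Lemma q3E a b c d : q3 (mkquat a b c d) = d.
Proof. by rewrite /q3 /qcoord mxE. Qed.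
Definition qE := (q0E, q1E, q2E, q3E).

Lemma q0D p q : q0 (p + q) = q0 p + q0 q.
Proof. exact: mxE. Qed.
Lemma q1D p q : q1 (p + q) = q1 p + q1 q.
Proof. exact: mxE. Qed.
Lemma q2D p q : q2 (p + q) = q2 p + q2 q.
Proof. exact: mxE. Qed.
Lemma q3D p q : q3 (p + q) = q3 p + q3 q.
Proof. exact: mxE. Qed.
Definition qD := (q0D, q1D, q2D, q3D).

Fact qmulA : associative qmul.
Proof. by move=> p q r; apply: quatP; rewrite !qE; ring. Qed.

Fact qmul1q : left_id qone qmul.
Proof. by move=> p; apply: quatP; rewrite !qE; ring. Qed.

Fact qmulq1 : right_id qone qmul.
Proof. by move=> p; apply: quatP; rewrite !qE; ring. Qed.

Fact qmulDl : left_distributive qmul (fun p q => p + q).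
Proof. by move=> p q r; apply: quatP; rewrite !(qD, qE); ring. Qed.

Fact qmulDr : right_distributive qmul (fun p q => p + q).
Proof. by move=> p q r; apply: quatP; rewrite !(qD, qE); ring. Qed.

Fact qone_neq0 : qone != 0.
Proof.
apply/eqP => /(congr1 q0); rewrite q0E {1}/q0 /qcoord mxE => /eqP.
by rewrite oner_eq0.
Qed.

HB.instance Definition _ := GRing.Zmodule_isNzRing.Build (quat R)
  qmulA qmul1q qmulq1 qmulDl qmulDr qone_neq0.

Definition qreal (a : R) : quat R := mkquat a 0 0 0.
Definition qi : quat R := mkquat 0 1 0 0.
Definition qj : quat R := mkquat 0 0 1 0.
Definition qk : quat R := mkquat 0 0 0 1.

Definition qconj q : quat R := mkquat (q0 q) (- q1 q) (- q2 q) (- q3 q).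

Definition qnneg p : Prop := exists2 a : R, 0 <= a & p = qreal a.

Definition qSigma : set (quat R) := [set 1; qi; qj; qk].

End QuatRing.

Section QuatPoly.
Context {R : realType}.
Local Notation H := (quat R).

Definition Hspan (F : set (H -> H)) : set (H -> H) :=
  [set f | exists n (a b : 'I_n -> H) (g : 'I_n -> H -> H),
     (forall i, F (g i)) /\ f = fun q => \sum_(i < n) a i * g i q * b i].

(** [(q^* )^m_0 q^n_0 s_1 (q^* )^m_1 q^n_1 ... s_k (q^* )^m_k q^n_k]: the
    exponents are indexed by [{0..k}], and [s i] is the letter [s_(i+1)]. *)
Definition Hword (k : nat) (m n : 'I_k.+1 -> nat) (s : 'I_k -> H) : H -> H :=
  fun q => qconj q ^+ m ord0 * q ^+ n ord0 *
    \prod_(i < k)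
      (s i * qconj q ^+ m (lift ord0 i) * q ^+ n (lift ord0 i)).

Definition Hpoly_fin (k : nat) : set (H -> H) :=
  Hspan [set f | exists m n s, (forall i, qSigma (s i)) /\
                               f = @Hword k m n s].

(** Indices range over N_0 with infinity adjoined: [None] is infinity. *)
Definition Hpoly (k : option nat) : set (H -> H) :=
  if k is Some k then Hpoly_fin k else \bigcup_k Hpoly_fin k.

(** A functional is a total map of which only the values on the subspace
    matter; linearity is required on that subspace. *)
Definition Hlinear_on (V : set (H -> H)) (L : (H -> H) -> H) : Prop :=
  forall f g, V f -> V g -> forall a b c d : H,
    L (fun q => a * f q * b + c * g q * d) = a * L f * b + c * L g * d.

Definition poly4_fun (p : mpoly 4 R) : H -> R :=
  fun q => meval (fun i => qcoord i q) p.

(** An element of [R[x0, x1^2 + x2^2 + x3^2]] *)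
Definition axial_fun (p : mpoly 2 R) : H -> R :=
  fun q => meval (fun i : 'I_2 =>
    if i == ord0 then q0 q else q1 q ^+ 2 + q2 q ^+ 2 + q3 q ^+ 2) p.

(** [x1^(a 0) x2^(a 1) x3^(a 2)] *)
Definition imag_monomial (a : multinom 3) : H -> R :=
  fun q => \prod_(i < 3) qcoord (lift ord0 i) q ^+ a i.

(** [bmultinom 3 k.+2] is the finite type of multi-indices [a] in N_0^3 with
    [|a| < k.+2]. *)
Definition Epoly (k : option nat) : set (H -> R) :=
  if k is Some k then
    [set f | exists p : bmultinom 3 k.+2 -> mpoly 2 R,
       f = fun q => \sum_(a : bmultinom 3 k.+2)
                      imag_monomial a q * axial_fun (p a) q]
  else range poly4_fun.

(** The elements of [Epos] are real-valued; composition with [qreal] turns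
    them into elements of [Hpoly k]. *)
Definition Epos (k : option nat) (K : set H) : set (H -> R) :=
  [set f | Epoly k f /\ forall x, K x -> 0 <= f x].

Definition K_positive (k : option nat) (K : set H) (L : (H -> H) -> H) :=
  forall f, Epos k K f -> qnneg (L (fun q => qreal (f q))).

Definition weakly_K_positive (k : option nat) (K : set H)
    (L : (H -> H) -> H) :=
  forall f, Epos k K f -> exists2 h, Epos k K h &
    forall eps : R, 0 < eps -> qnneg (L (fun q => qreal (f q + eps * h q))).

Definition is_radon (mu : {measure set H -> \bar R}) : Prop :=
  (forall C : set H, compact C -> (mu C < +oo)%E) /\
  (forall A : set H, measurable A ->
     mu A = ereal_sup [set mu C | C in [set C | compact C /\ C `<=` A]]).

Definition measure_supp (mu : {measure set H -> \bar R}) : set H :=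
  [set x | forall U : set H, open U -> U x -> (0 < mu U)%E].

Definition qintegrable (mu : {measure set H -> \bar R}) (f : H -> H) : Prop :=
  forall i, mu.-integrable setT (fun q => (qcoord i (f q))%:E).

Definition qintegral (mu : {measure set H -> \bar R}) (f : H -> H) : H :=
  \row_i \int[mu]_q qcoord i (f q).

Definition K_moment_functional (k : option nat) (K : set H)
    (L : (H -> H) -> H) :=
  exists mu : {measure set H -> \bar R},
    [/\ is_radon mu, measure_supp mu `<=` K &
        forall f, Hpoly k f -> qintegrable mu f /\ L f = qintegral mu f].

End QuatPoly.

(* Main.v *)
Require Import Defs.
From mathcomp Require Import all_boot all_order all_algebra finmap.
From mathcomp Require Import all_classical all_reals all_analysis.
From HB Require Import structures.
From mathcomp Require Import measurable_realfun.
From mathcomp Require Import ring lra.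

(** The space of real polynomials attached to [H^k] is adapted in Choquet's
    sense: it contains the powers of [1 + |q|^2] and each of its elements is
    bounded by such a power. Hahn-Banach extends the positive functional from it
    to all functions on [K] that it dominates; evaluated at indicators, the
    extension is a finitely additive set function on all subsets. On the
    space of ultrafilters, where the subsets become clopen sets, it is
    countably additive by compactness, hence extends to a measure. Adaptedness
    says that no mass sits on ultrafilters without a limit in [K], so
    the image of that measure under the limit map is a Radon measure on [K],
    and it represents the functional.

    Algebraically, the coordinates of a word with [k] letters are polynomials of
    degree at most [k + 1] in the imaginary coordinates with coefficients
    in [R[x0, |Im q|^2]], because [q^n] lies in the span of [1] and [Im q] over
    that ring; conversely each imaginary coordinate is [(e (qconj q) - q e) / 2]
    for an imaginary unit [e]. *)

Set Implicit Arguments.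
Unset Strict Implicit.
Unset Printing Implicit Defensive.
Import Order.TTheory GRing.Theory Num.Theory.
Import numFieldNormedType.Exports.
Local Open Scope classical_set_scope.
Local Open Scope ring_scope.

(** * Hahn-Banach for sublinear functionals on a subspace *)

(** For finite [k] the space [Epoly k] is closed neither under products nor under maxima, so the
    analytic part relies only on its linear structure, on positivity over [K], on continuity and on
    adaptedness. Adaptedness is available even for [k = 0], because 1 + |q|^2 is itself a polynomial
    in x0 and |Im q|^2. The set function that Hahn-Banach yields has no reason to be countably
    additive on the original space. Among ultrafilters a countable cover of a clopen set by clopen
    sets has a finite subcover, so there finite additivity suffices; the price is that the mass must
    be brought back by a limit map, and adaptedness pays it. The bound k + 1 counts blocks: k
    letters separate k + 1 factors [qconj q ^+ m * q ^+ n], each of degree at most 1 in Im q. The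
    quaternionic values reduce to real ones: a real polynomial is a difference of two that are
    nonnegative on [K], so a [K]-positive [L] is real on it, and right linearity recovers [L F] from
    the four coordinates of [F]. *)

Section HahnBanach.
Context {R : realType} {V : lmodType R}.
Variable F : set V.
Hypothesis FD : forall x y, F x -> F y -> F (x + y).
Hypothesis FZ : forall (c : R) x, F x -> F (c *: x).
Implicit Types (p q : V -> R) (x y : V).

Let FN x : F x -> F (- x).
Proof. by rewrite -scaleN1r; exact: FZ. Qed.

Definition sublinear_on p :=
  (forall x y, F x -> F y -> p (x + y) <= p x + p y) /\
  (forall c x, 0 < c -> F x -> p (c *: x) <= c * p x).

(** The inequality for [c^-1] at the point [c *: x] is the reverse of the one for [c] at [x]. *)
Lemma sublinear_onZ p c x : sublinear_on p -> 0 < c -> F x ->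
  p (c *: x) = c * p x.
Proof.
move=> [_ pZ] c0 Fx; apply/le_anti; rewrite pZ//=.
have := pZ c^-1 _ (_ : 0 < c^-1) (FZ c Fx).
by rewrite invr_gt0 scalerA mulVf ?gt_eqF// scale1r ler_pdivlMl//; exact.
Qed.

Lemma sublinear_on0 p : F 0 -> sublinear_on p -> p 0 = 0.
Proof.
move=> F0 /sublinear_onZ/(_ (ltr0n R 2) F0); rewrite scaler0 => p0.
lra.
Qed.

(** Subadditivity at [x] and [- x], together with [p 0 = 0]. This is what bounds a chain of
    sublinear functions from below. *)
Lemma sublinear_on_opp p x : sublinear_on p -> F x -> - p (- x) <= p x.
Proof.
move=> ps Fx; rewrite lerNl -subr_ge0 opprK.
rewrite -(@sublinear_on0 p) ?ps//; last by rewrite -(scale0r x); exact: FZ.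
by rewrite -[X in p X](addNr x); apply: ps.1 => //; exact: FN.
Qed.

(* Zorn's lemma gives a minimal sublinear [q <= p]; comparing [q] with
   [z |-> inf_(t >= 0) (q (z + t y) - t (q y))] shows that it is additive. The
   competitors are set to [0] outside [F] to make the order antisymmetric. *)
Theorem sublinear_dominated_linear p : F !=set0 -> sublinear_on p ->
  exists l : V -> R,
    [/\ forall x y, F x -> F y -> l (x + y) = l x + l y,
        forall c x, F x -> l (c *: x) = c * l x &
        forall x, F x -> l x <= p x].
Proof.
move=> [x0 Fx0] ps.
have F0 : F 0 by rewrite -(scale0r x0); exact: FZ.
pose P := [set q | [/\ sublinear_on q, forall x, F x -> q x <= p x &
                       forall x, ~ F x -> q x = 0]].
pose S := {q | P q}.
(* The order is reversed, so that a maximal element for Zorn is a minimal sublinear function. *)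
pose D (s t : S) : bool := `[< forall x, F x -> sval t x <= sval s x >].
have mkP (f : V -> R) : sublinear_on f -> (forall x, F x -> f x <= p x) ->
    P (fun x => if x \in F then f x else 0).
  move=> [fD fZ] fp; split.
  - split=> [x y Fx Fy|c x c0 Fx].
      by rewrite !mem_set//; [exact: fD | exact: FD].
    by rewrite !mem_set//; [exact: fZ | exact: FZ].
  - by move=> x Fx; rewrite mem_set//; exact: fp.
  - by move=> x Fx; rewrite memNset.
have Ssub (s : S) : sublinear_on (sval s) by have [] := svalP s.
have [||||[q qP] qmin] := @Zorn S D.
- by move=> s; apply/asboolP => x.
- move=> r s t /asboolP rs /asboolP st; apply/asboolP => x Fx.
  exact: le_trans (st _ Fx) (rs _ Fx).
- move=> [s sP] [t tP] /asboolP /= st /asboolP /= ts; apply: eq_exist.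
  apply/funext => x; have [Fx|Fx] := pselect (F x).
    by apply/le_anti; rewrite st// ts.
  by case: sP => _ _ ->//; case: tP => _ _ ->.
- move=> A Atot.
  have [[s0 As0]|A0] := pselect (A !=set0); last first.
    exists (exist _ _ (mkP p ps (fun x _ => lexx _))) => s As.
    by case: A0; exists s.
  pose B x := [set sval s x | s in A].
  have Bne x : B x !=set0 by exists (sval s0 x), s0.
  have Blb x : F x -> has_lbound (B x).
    move=> Fx; exists (- p (- x)) => _ [s As <-].
    have [ss sp _] := svalP s.
    apply: le_trans (sublinear_on_opp ss Fx).
    by rewrite lerN2; apply: sp; exact: FN.
  have Binf x s : F x -> A s -> inf (B x) <= sval s x.
    by move=> Fx As; apply: ge_inf; [exact: Blb | exists s].
  have is_sub : sublinear_on (fun x => inf (B x)).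
    split=> [x y Fx Fy|c x c0 Fx].
      rewrite -lerBlDr; apply: lb_le_inf => // _ [s As <-].
      rewrite lerBlDr -lerBlDl; apply: lb_le_inf => // _ [t At <-].
      rewrite lerBlDl.
      have Fxy := FD Fx Fy.
      (* An infimum of sublinear functions need not be subadditive; along a chain it is, since the
         smaller of [s] and [t] can be used for both summands. *)
      have [|] := Atot s t As At => /asboolP st.
        apply: (le_trans (Binf _ t Fxy At)).
        apply: (le_trans ((Ssub t).1 _ _ Fx Fy)).
        by apply: lerD => //; exact: st.
      apply: (le_trans (Binf _ s Fxy As)).
      apply: (le_trans ((Ssub s).1 _ _ Fx Fy)).
      by apply: lerD => //; exact: st.
    rewrite -ler_pdivrMl//; apply: lb_le_inf => // _ [s As <-].
    rewrite ler_pdivrMl//; apply: le_trans (Binf _ s _ As) _; first exact: FZ.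
    exact: (Ssub s).2.
  have is_dom x : F x -> inf (B x) <= p x.
    move=> Fx; apply: le_trans (Binf _ _ Fx As0) _.
    by have [_ + _] := svalP s0; exact.
  exists (exist _ _ (mkP _ is_sub is_dom)) => s As; apply/asboolP => x Fx /=.
  by rewrite mem_set//; exact: Binf.
have [qs qp q0] := qP.
have qD x y : F x -> F y -> q (x + y) = q x + q y.
  move=> Fx Fy; apply/le_anti; rewrite qs.1//=.
  pose B z := [set q (z + t *: y) - t * q y | t in [set t : R | 0 <= t]].
  have Bne z : B z !=set0 by exists (q (z + 0 *: y) - 0 * q y); exists 0 => /=.
  have qty t : 0 <= t -> q (t *: y) = t * q y.
    rewrite le_eqVlt => /orP[/eqP <-|t0].
      by rewrite scale0r mul0r (sublinear_on0 F0 qs).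
    exact: sublinear_onZ.
  have Blb z : F z -> has_lbound (B z).
    move=> Fz; exists (- q (- z)) => _ [t /= t0 <-].
    rewrite lerBrDl -qty// lerBlDr.
    have /(fun h => qs.1 _ _ h (FN Fz)) : F (z + t *: y).
      by apply: FD => //; exact: FZ.
    by rewrite addrAC subrr add0r.
  have Binf z t : F z -> 0 <= t -> inf (B z) <= q (z + t *: y) - t * q y.
    by move=> Fz t0; apply: ge_inf; [exact: Blb | exists t].
  have Binfq z : F z -> inf (B z) <= q z.
    move=> Fz; apply: le_trans (Binf z 0 Fz (lexx _)) _.
    by rewrite scale0r mul0r addr0 subr0.
  have is_sub : sublinear_on (fun z => inf (B z)).
    split=> [z w Fz Fw|c z c0 Fz].
      rewrite -lerBlDr; apply: lb_le_inf => // _ [s /= s0 <-].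
      rewrite lerBlDr -lerBlDl; apply: lb_le_inf => // _ [t /= t0 <-].
      rewrite lerBlDl.
      apply: le_trans (Binf _ (s + t) (FD Fz Fw) _) _; first exact: addr_ge0.
      have : q (z + s *: y + (w + t *: y)) <= q (z + s *: y) + q (w + t *: y).
        by apply: qs.1; apply: FD => //; exact: FZ.
      by rewrite addrACA -scalerDl; lra.
    rewrite -ler_pdivrMl//; apply: lb_le_inf => // _ [t /= t0 <-].
    rewrite ler_pdivrMl//.
    apply: le_trans (Binf _ (c * t) (FZ _ Fz) _) _.
      by apply: mulr_ge0 => //; exact: ltW.
    rewrite -scalerA -scalerDr sublinear_onZ// ?mulrBr ?mulrA//.
    by apply: FD => //; exact: FZ.
  have is_dom z : F z -> inf (B z) <= p z.
    by move=> Fz; apply: le_trans (Binfq _ Fz) (qp _ Fz).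
  (* Minimality gives [q x = inf (B x)], and the member [t = 1] of [B x] is [q (x + y) - q y]. *)
  have /qmin/(congr1 (fun s : S => sval s x))/= :
      D (exist _ q qP) (exist _ _ (mkP _ is_sub is_dom)).
    by apply/asboolP => z Fz /=; rewrite mem_set//; exact: Binfq.
  rewrite mem_set// => <-.
  rewrite -lerBrDr; apply: le_trans (Binf x 1 Fx ler01) _.
  by rewrite scale1r mul1r.
exists q; split => // c x Fx.
have qN y : F y -> q (- y) = - q y.
  move=> Fy; apply/eqP; rewrite -addr_eq0 -qD ?addNr; last 2 first.
  - exact: FN.
  - by [].
  by rewrite (sublinear_on0 F0 qs).
have [c0|c0|->] := ltgtP c 0.
- rewrite -[c]opprK scaleNr qN; last exact: FZ.
  by rewrite sublinear_onZ// ?mulNr// oppr_gt0.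
- exact: sublinear_onZ.
- by rewrite scale0r mul0r (sublinear_on0 F0 qs).
Qed.

End HahnBanach.

(** * Finitely additive set functions as measures on ultrafilters *)

(** The Stone space of the power set of [T], that is, the Stone-Cech compactification of [T] taken
    as a discrete space; [stoneset A] is its basic clopen set. It gets no topology here: compactness
    enters as [stone_meet]. *)
Definition stone (T : Type) := {u : set_system T | UltraFilter u}.

#[export] Instance stone_ultra {T : Type} (u : stone T) : UltraFilter (sval u).
Proof. exact: svalP. Qed.

Definition stone_principal {T : Type} (x : T) : stone T :=
  exist _ (principal_filter x) (principal_filter_ultra x).

Definition stoneset {T : Type} (A : set T) : set (stone T) :=
  [set u | sval u A].

HB.instance Definition _ (T : Type) := gen_eqMixin (stone T).
HB.instance Definition _ (T : Type) := gen_choiceMixin (stone T).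
HB.instance Definition _ (T : pointedType) :=
  isPointed.Build (stone T) (stone_principal point).

Section Stone.
Context {T : Type}.
Implicit Types (A B : set T) (u : stone T).

Lemma stonesetI A B : stoneset (A `&` B) = stoneset A `&` stoneset B.
Proof.
apply/seteqP; split => u /=; last by move=> [uA uB]; exact: filterI.
by move=> uAB; split; apply: filterS uAB.
Qed.

Lemma stoneset_not0 u : ~ stoneset set0 u.
Proof. exact: filter_not_empty. Qed.

Lemma stonesetC A : stoneset (~` A) = ~` stoneset A.
Proof.
apply/seteqP; split => u /=.
  move=> uCA uA; apply: (@stoneset_not0 u).
  by rewrite -(setICr A); exact: (filterI (uA : sval u A)).
by move=> nuA; have [uA|//] := in_ultra_setVsetC A (stone_ultra u); case: nuA.
Qed.

Lemma stonesetU A B : stoneset (A `|` B) = stoneset A `|` stoneset B.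
Proof.
by rewrite -[A `|` B]setCK setCU stonesetC stonesetI !stonesetC setCI !setCK.
Qed.

Lemma stoneset0 : stoneset (@set0 T) = set0.
Proof. by apply/seteqP; split => // u /stoneset_not0 []. Qed.

Lemma stoneset_setT : stoneset [set: T] = setT.
Proof. by rewrite -setC0 stonesetC stoneset0 setC0. Qed.

Lemma subset_stoneset A B : A `<=` B -> stoneset A `<=` stoneset B.
Proof. by move=> AB u uA; exact: filterS uA. Qed.

(** Hence a set function on [T] is transported to clopen sets by pulling back along principal
    ultrafilters, without choosing a representative [A]. *)
Lemma stoneset_principal A : stone_principal @^-1` stoneset A = A.
Proof.
by apply/seteqP; split => x; rewrite /preimage/= => /principal_filterP.
Qed.

(** The [D n] generate a proper filter, and an ultrafilter refining it contains them all. This is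
    countable compactness of the space of ultrafilters. *)
Lemma stone_meet (D : nat -> set T) :
  (forall n, D n.+1 `<=` D n) -> (forall n, D n !=set0) ->
  exists u, forall n, stoneset (D n) u.
Proof.
move=> Dsub Dne.
have Dle m n : (m <= n)%N -> D n `<=` D m.
  elim: n => [|n IHn]; first by rewrite leqn0 => /eqP->.
  rewrite leq_eqVlt => /orP[/eqP->//|/IHn]; exact: subset_trans (@Dsub n).
have FF : ProperFilter (filter_from setT D).
  apply: filter_from_proper; last by move=> n _; exact: Dne.
  apply: filter_fromT_filter; first by exists 0%N.
  move=> i j; exists (maxn i j).
  by rewrite subsetI; split; apply: Dle; [exact: leq_maxl|exact: leq_maxr].
have [u [uU Fu]] := ultraFilterLemma FF.
by exists (exist _ u uU) => n; apply: Fu; exists n.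
Qed.

(** If no finite union covers [A], the remainders of [A] decrease and are nonempty, and an
    ultrafilter containing all of them escapes the cover. It reduces countable subadditivity on
    clopen sets to the finite one. *)
Lemma stone_compact A (B : nat -> set T) :
  stoneset A `<=` \bigcup_n stoneset (B n) ->
  exists n, A `<=` \big[setU/set0]_(i < n) B i.
Proof.
move=> AB; apply: contrapT => /forallNP noN.
pose D n := A `\` \big[setU/set0]_(i < n) B i.
have [||u uD] := @stone_meet D.
- move=> n x [Ax]; rewrite big_ord_recr/= => nB; split=> // Bx.
  by apply: nB; left.
- move=> n; apply: contrapT => D0; apply: (noN n) => x Ax.
  by apply: contrapT => nx; apply: D0; exists x.
have uA : stoneset A u by apply: subset_stoneset (uD 0%N) => x [].
have [n _ uB] := AB _ uA.
have : stoneset (B n `&` D n.+1) u by rewrite stonesetI; split.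
rewrite (_ : _ `&` _ = set0) ?stoneset0// -subset0 => x [Bx [_]].
by rewrite big_ord_recr/=; apply; right.
Qed.

End Stone.

(** The clopen sets form an algebra only: a countable union of them need not be clopen. The measure
    is therefore obtained by Caratheodory extension. *)
HB.instance Definition _ (T : pointedType) :=
  @isAlgebraOfSets.Build default_measure_display (stone T)
    (range (@stoneset T))
    (ex_intro2 _ _ set0 I stoneset0)
    (fun _ _ '(ex_intro2 A _ eA) '(ex_intro2 B _ eB) =>
      ex_intro2 _ _ (A `|` B) I
        (etrans (stonesetU A B) (f_equal2 setU eA eB)))
    (fun _ '(ex_intro2 A _ eA) =>
      ex_intro2 _ _ (~` A) I (etrans (stonesetC A) (f_equal setC eA))).

Section StoneMeasure.
Context {R : realType} {T : pointedType}.
Variable m : set T -> R.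
Hypothesis m_ge0 : forall A, 0 <= m A.
Hypothesis mU : forall A B, A `&` B = set0 -> m (A `|` B) = m A + m B.

Lemma fin_additive0 : m set0 = 0.
Proof. by have := mU (setI0 set0); rewrite setU0; lra. Qed.

Lemma fin_additive_le A B : A `<=` B -> m A <= m B.
Proof.
move=> AB; rewrite -(setDUK AB) mU ?lerDl//.
by rewrite -subset0 => x [Ax []].
Qed.

Lemma fin_additive_bigsetU (A : nat -> set T) n :
  m (\big[setU/set0]_(i < n) A i) <= \sum_(i < n) m (A i).
Proof.
elim: n => [|n IHn]; first by rewrite !big_ord0 fin_additive0.
rewrite !big_ord_recr/=; set U := \big[_/_]_(i < n) _.
have -> : U `|` A n = U `|` (A n `\` U) by rewrite setDE setUIr setUCr setIT.
rewrite mU; last by rewrite setDE setICA setICr setI0.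
by rewrite lerD// fin_additive_le.
Qed.

(** The second clause is outer regularity by clopen sets, read off the infimum that defines the
    outer measure. Applied to a complement, it later produces compact sets inside a Borel set. *)
Theorem stone_measure :
  exists nu : {measure set g_sigma_algebraType (range (@stoneset T)) -> \bar R},
    (forall A, nu (stoneset A) = (m A)%:E) /\
    (forall S (e : R), 0 < e -> exists A : nat -> set T,
       S `<=` \bigcup_n stoneset (A n) /\
       (\sum_(n <oo) nu (stoneset (A n)) <= nu S + e%:E)%E).
Proof.
pose c (S : set (stone T)) : \bar R := (m (stone_principal @^-1` S))%:E.
have cE A : c (stoneset A) = (m A)%:E by rewrite /c stoneset_principal.
have c0 : c set0 = 0%E by rewrite /c preimage_set0 fin_additive0.
have c_ge0 S : (0 <= c S)%E by rewrite lee_fin.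
have c_add : measure_function.semi_additive c.
  apply/(additive2P c0) => A B _ _ AB.
  by rewrite /c preimage_setU mU// -preimage_setI AB preimage_set0.
pose cc : {content set (stone T) -> \bar R} :=
  HB.pack c (isContent.Build _ _ _ c c_ge0 c_add).
have c_sub : measurable_subset_sigma_subadditive c.
  move=> S F mF [A _ <-] AF.
  pose G n := stone_principal @^-1` (F n).
  have FG n : F n = stoneset (G n).
    by rewrite /G; case: (mF n) => B _ <-; rewrite stoneset_principal.
  have [N AN] : exists N, A `<=` \big[setU/set0]_(i < N) G i.
    by apply: stone_compact => u /AF[n _]; rewrite FG => uG; exists n.
  rewrite cE; apply: (@le_trans _ _ (\sum_(i < N) c (F i))%E).
    rewrite sumEFin lee_fin; apply: le_trans (fin_additive_le AN) _.
    exact: fin_additive_bigsetU.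
  rewrite -(big_mkord xpredT (fun i => c (F i))).
  exact: nneseries_lim_ge.
have c_sig : semi_sigma_additive c := @semiring_sigma_additive _ _ _ cc c_sub.
pose mc : {measure set (stone T) -> \bar R} :=
  HB.pack c (isMeasure.Build _ _ _ c c0 c_ge0 c_sig).
have nuE A : measure_extension mc (stoneset A) = (m A)%:E.
  by rewrite /measure_extension measurable_mu_extE//; exists A.
exists (measure_extension mc); split => // S e e0.
have fS : measure_extension mc S \is a fin_num.
  rewrite ge0_fin_numE ?measure_ge0//.
  apply: (@le_lt_trans _ _ (m setT)%:E); last by rewrite ltry.
  by rewrite -nuE; apply: le_mu_ext; rewrite stoneset_setT.
have [_ [F [mF SF] <-] Fe] := lb_ereal_inf_adherent e0 fS.
pose G n := stone_principal @^-1` (F n).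
have FG n : F n = stoneset (G n).
  by rewrite /G; case: (mF n) => B _ <-; rewrite stoneset_principal.
exists G; split.
  by move=> u /SF[n _]; rewrite FG => ?; exists n.
apply: le_trans (ltW Fe); rewrite le_eqVlt; apply/orP; left; apply/eqP.
by apply: eq_eseriesr => n _; exact: (nuE (G n)).
Qed.

End StoneMeasure.

(** * Extension of positive functionals *)

Section PositiveExtension.
Context {R : realType} {T : Type}.
Variables (K : set T) (E : set (T -> R)) (L : (T -> R) -> R).
Hypothesis ED : forall f g, E f -> E g -> E (f + g).
Hypothesis EZ : forall (c : R) f, E f -> E (c *: f).
Hypothesis LD : forall f g, E f -> E g -> L (f + g) = L f + L g.
Hypothesis LZ : forall (c : R) f, E f -> L (c *: f) = c * L f.
Hypothesis L_ge0 : forall f, E f -> (forall x, K x -> 0 <= f x) -> 0 <= L f.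

(** The bound is asked on [K] only, so that the extended functional ignores values off [K]. *)
Definition dominated_by : set (T -> R) :=
  [set f | exists2 g, E g & forall x, K x -> `|f x| <= g x].

Lemma dominated_byD f g :
  dominated_by f -> dominated_by g -> dominated_by (f + g).
Proof.
move=> [f' Ef' ff'] [g' Eg' gg']; exists (f' + g'); first exact: ED.
by move=> x Kx; rewrite (le_trans (ler_normD _ _))// lerD// ?ff'// gg'.
Qed.

Lemma dominated_byZ (c : R) f : dominated_by f -> dominated_by (c *: f).
Proof.
move=> [g Eg fg]; exists (`|c| *: g); first exact: EZ.
by move=> x Kx; rewrite normrM ler_wpM2l//; exact: fg.
Qed.

(** The sublinear function is the upper envelope [p f], the infimum of [L g] over the [g] in [E]
    above [f] on [K]. A linear [l <= p] is positive because [p (- f) <= L 0] when [f] is nonnegative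
    on [K], and it equals [L] on [E] because [p <= L] holds there for [f] and for [- f]. Belonging
    to [E] does not by itself make [f] dominated, whence the two premises of the last clause. *)
Theorem positive_functional_extension : E !=set0 ->
  exists l : (T -> R) -> R,
    [/\ forall f g, dominated_by f -> dominated_by g ->
          l (f + g) = l f + l g,
        forall (c : R) f, dominated_by f -> l (c *: f) = c * l f,
        forall f, dominated_by f -> (forall x, K x -> 0 <= f x) -> 0 <= l f &
        forall f, E f -> dominated_by f -> l f = L f].
Proof.
move=> [e Ee].
have E0 : E 0 by rewrite -(scale0r e); exact: EZ.
have L0 : L 0 = 0 by have := LZ 0 Ee; rewrite scale0r mul0r.
have EN f : E f -> E (- f) by rewrite -scaleN1r; exact: EZ.
have LB f g : E f -> E g -> L (f - g) = L f - L g.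
  move=> Ef Eg; have := LZ (-1) Eg; rewrite scaleN1r mulN1r => <-.
  by apply: LD => //; exact: EN.
have L_le f g : E f -> E g -> (forall x, K x -> f x <= g x) -> L f <= L g.
  move=> Ef Eg fg; rewrite -subr_ge0 -LB//; apply: L_ge0.
    by apply: ED => //; exact: EN.
  by move=> x Kx; rewrite subr_ge0 fg.
pose M (f : T -> R) := [set L g | g in [set g | E g /\ forall x, K x -> f x <= g x]].
pose p f := inf (M f).
have Mne f : dominated_by f -> M f !=set0.
  move=> [g Eg fg]; exists (L g), g => //; split => // x Kx.
  exact: le_trans (ler_norm _) (fg x Kx).
have Mlb f : dominated_by f -> has_lbound (M f).
  move=> [g Eg fg]; exists (L (- g)) => _ [h [Eh fh] <-].
  apply: L_le => //; first exact: EN.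
  move=> x Kx; apply: le_trans (fh x Kx).
  by have := fg x Kx; rewrite ler_norml => /andP[].
have p_le f g : dominated_by f -> E g -> (forall x, K x -> f x <= g x) ->
    p f <= L g.
  by move=> Ff Eg fg; apply: ge_inf; [exact: Mlb|exists g].
have psub : sublinear_on dominated_by p.
  split => [f g Ff Fg|c f c0 Ff].
    rewrite -lerBlDr; apply: lb_le_inf; first exact: Mne.
    move=> _ [f' [Ef' ff'] <-].
    rewrite lerBlDr -lerBlDl; apply: lb_le_inf; first exact: Mne.
    move=> _ [g' [Eg' gg'] <-]; rewrite lerBlDl -LD//.
    apply: p_le; [exact: dominated_byD|exact: ED|].
    by move=> x Kx; apply: lerD; [exact: ff'|exact: gg'].
  rewrite -ler_pdivrMl//; apply: lb_le_inf; first exact: Mne.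
  move=> _ [f' [Ef' ff'] <-]; rewrite ler_pdivrMl// -LZ//.
  apply: p_le; [exact: dominated_byZ|exact: EZ|].
  by move=> x Kx; apply: ler_wpM2l; [exact: ltW|exact: ff'].
have F0 : dominated_by 0 by exists 0 => // x _; rewrite normr0.
have [l [lD lZ lp]] := sublinear_dominated_linear dominated_byD dominated_byZ
  (ex_intro _ _ F0) psub.
exists l; split => //.
  move=> f Ff f0; have FNf : dominated_by (- f).
    by rewrite -scaleN1r; exact: dominated_byZ.
  rewrite -oppr_le0 -mulN1r -lZ// scaleN1r -L0.
  apply: le_trans (lp _ FNf) (p_le _ _ FNf E0 _) => x Kx.
  by rewrite oppr_le0 f0.
have l_le f : E f -> dominated_by f -> l f <= L f.
  by move=> Ef Ff; apply: le_trans (lp _ Ff) (p_le _ _ Ff Ef _).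
move=> f Ef Ff; apply/le_anti; rewrite l_le//=.
have := l_le (-1 *: f) (EZ _ Ef) (dominated_byZ _ Ff).
by rewrite lZ// LZ// !mulN1r lerN2.
Qed.

End PositiveExtension.

(** * Integration over the space of ultrafilters *)

Section StoneIntegral.
Context {R : realType} {T : pointedType}.
Local Notation X := (g_sigma_algebraType (range (@stoneset T))).

(** For bounded [h] this says that [g u] is the limit of [h] along [u], expressed through level
    sets: for each [a] the ultrafilter contains one of the two sets. *)
Definition stone_extends (h : T -> R) (g : X -> R) :=
  forall u a, (stoneset [set x | a <= h x] u -> a <= g u) /\
              (stoneset [set x | h x <= a] u -> g u <= a).

Lemma measurable_stoneset (A : set T) : measurable (stoneset A : set X).
Proof. by apply: sub_sigma_algebra; exists A. Qed.

Lemma stone_extends_le (h : T -> R) g (M : R) :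
  stone_extends h g -> (forall x, h x <= M) -> forall u, g u <= M.
Proof.
move=> hg hM u; apply: (hg u M).2.
rewrite (_ : [set _ | _] = setT) ?stoneset_setT//.
by apply/seteqP; split => // x _; exact: hM.
Qed.

Lemma stone_extends_ge (h : T -> R) g (M : R) :
  stone_extends h g -> (forall x, M <= h x) -> forall u, M <= g u.
Proof.
move=> hg hM u; apply: (hg u M).1.
rewrite (_ : [set _ | _] = setT) ?stoneset_setT//.
by apply/seteqP; split => // x _; exact: hM.
Qed.

Lemma stone_extends_measurable h g : stone_extends h g ->
  measurable_fun setT g.
Proof.
move=> hg mX; apply: (measurability _ (RGenOInfty.measurableE R)) => //.
move=> /= _ [_ [a ->] <-]; rewrite setTI.
(* The margin [n.+1%:R^-1] absorbs the loss of strictness in passing from [h] to [g], so that a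
   strict superlevel set of [g] is exactly a countable union of clopen sets. *)
rewrite (_ : _ @^-1` _ =
    \bigcup_n (stoneset [set x | a + n.+1%:R^-1 <= h x] : set X)).
  by apply: bigcup_measurable => n _; exact: measurable_stoneset.
apply/seteqP; split => u /=.
  rewrite in_itv/= andbT => au; apply: contrapT => nu.
  have [n an] : exists n, a + n.+1%:R^-1 < g u.
    have /ltr_add_invr[n na] := au; by exists n.
  have : g u <= a + n.+1%:R^-1.
    apply: (hg u _).2.
    have : (~` stoneset [set x | a + n.+1%:R^-1 <= h x]) u.
      by move=> un; apply: nu; exists n.
    rewrite -stonesetC; apply: subset_stoneset => x /=.
    by move/negP; rewrite -ltNge => /ltW.
  by rewrite leNgt an.
move=> [n _] /(hg u _).1 an; rewrite in_itv/= andbT.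
by rewrite (lt_le_trans _ an)// ltrDl.
Qed.

(** Each ultrafilter contains [A] or its complement, and on either of these sets the subtracted
    function is constant. *)
Lemma stone_extendsB h g (c : R) (A : set T) : stone_extends h g ->
  stone_extends (h - c *: (\1_A : T -> R))
                (g - c *: (\1_(stoneset A : set X) : X -> R)).
Proof.
have xE (x : T) : (h - c *: (\1_A : T -> R)) x = h x - c * (x \in A)%:R by [].
move=> hg u a.
have -> : (g - c *: (\1_(stoneset A : set X) : X -> R)) u =
  g u - c * (u \in (stoneset A : set X))%:R by [].
have [uA|uA] := boolP (u \in (stoneset A : set X)).
  rewrite mulr1; rewrite inE in uA; split=> ua.
    rewrite lerBrDr; apply: (hg u _).1.
    apply: (@subset_stoneset _ (A `&` [set x | a <= (h - c *: (\1_A : T -> R)) x])).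
      by move=> x /= [Ax]; rewrite xE mem_set// mulr1 lerBrDr.
    by rewrite stonesetI.
  rewrite lerBlDr; apply: (hg u _).2.
  apply: (@subset_stoneset _ (A `&` [set x | (h - c *: (\1_A : T -> R)) x <= a])).
    by move=> x /= [Ax]; rewrite xE mem_set// mulr1 lerBlDr.
  by rewrite stonesetI.
have {}uA : stoneset (~` A) u.
  by rewrite stonesetC => ?; move/negP : uA; apply; rewrite inE.
rewrite mulr0 subr0; split=> ua.
  apply: (hg u _).1.
  apply: (@subset_stoneset _ (~` A `&` [set x | a <= (h - c *: (\1_A : T -> R)) x])).
    by move=> x /= [Ax]; rewrite xE memNset// mulr0 subr0.
  by rewrite stonesetI.
apply: (hg u _).2.
apply: (@subset_stoneset _ (~` A `&` [set x | (h - c *: (\1_A : T -> R)) x <= a])).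
  by move=> x /= [Ax]; rewrite xE memNset// mulr0 subr0.
by rewrite stonesetI.
Qed.

Variable nu : {measure set X -> \bar R}.
Variable l : (T -> R) -> R.
Let bnd (f : T -> R) := exists M : R, forall x, `|f x| <= M.
Hypothesis lD : forall f g, bnd f -> bnd g -> l (f + g) = l f + l g.
Hypothesis lZ : forall (c : R) f, bnd f -> l (c *: f) = c * l f.
Hypothesis l_ge0 : forall f, bnd f -> (forall x, 0 <= f x) -> 0 <= l f.
Hypothesis nuE : forall A, nu (stoneset A) = (l \1_A)%:E.

Let bnd1 A : bnd \1_A.
Proof.
by exists 1 => x; rewrite indicE; case: (_ \in _); rewrite ?normr1 ?normr0.
Qed.

Let bndD f g : bnd f -> bnd g -> bnd (f + g).
Proof.
move=> [M fM] [N gN]; exists (M + N) => x.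
by rewrite (le_trans (ler_normD _ _))// lerD.
Qed.

Let bndZ (c : R) f : bnd f -> bnd (c *: f).
Proof.
move=> [M fM]; exists (`|c| * M) => x.
by rewrite normrM ler_wpM2l//; exact: fM.
Qed.

Let l_le f g : bnd f -> bnd g -> (forall x, f x <= g x) -> l f <= l g.
Proof.
move=> bf bg fg; rewrite -subr_ge0 -mulN1r -lZ// -lD//; last exact: bndZ.
apply: l_ge0; first by apply: bndD => //; exact: bndZ.
by move=> x; rewrite scaleN1r; have := fg x; rewrite -subr_ge0.
Qed.

Let bnd_itv (h : T -> R) (M : R) : (forall x, 0 <= h x <= M) -> bnd h.
Proof. by move=> hM; exists M => x; rewrite ger0_norm; have /andP[] := hM x. Qed.

(* Subtracting [e 1_(h >= e)] from [h] and [e] times the indicator of the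
   corresponding clopen set from [g] lowers the range by [e] and preserves
   [stone_extends], so [l h] and the integral of [g] differ by [O(e)]. *)
Theorem stone_integral (h : T -> R) (g : X -> R) (M : R) :
  (forall x, 0 <= h x <= M) -> stone_extends h g -> (\int[nu]_u (g u)%:E = (l h)%:E)%E.
Proof.
move=> hM hg.
have nuT : nu setT = (l \1_setT)%:E by rewrite -nuE stoneset_setT.
(* Induction on the number of layers of height [e]. Errors do not accumulate: a removed layer
   contributes exactly [e * l \1_A] to both sides, and only the last one, with values in [0, e], is
   estimated. *)
have approx (e : R) N : 0 < e -> forall (h : T -> R) (g : X -> R),
    (forall x, 0 <= h x <= N.+1%:R * e) ->
    stone_extends h g -> exists r, (\int[nu]_u (g u)%:E = r%:E)%E /\
      `|l h - r| <= e * l \1_setT.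
  move=> e0; elim: N => [|N IHN] {hM hg}h {}g hN hg.
    have mg : measurable_fun setT (EFin \o g : X -> \bar R).
      by apply/measurable_EFinP; exact: stone_extends_measurable hg.
    have g0 u : 0 <= g u.
      by apply: (stone_extends_ge hg) => x; have /andP[] := hN x.
    have ge u : g u <= e.
      apply: (stone_extends_le hg) => x.
      by have /andP[] := hN x; rewrite mul1r.
    have i0 : (0 <= \int[nu]_u (g u)%:E)%E.
      by apply: integral_ge0 => u _; rewrite lee_fin.
    have ie : (\int[nu]_u (g u)%:E <= (e * l \1_setT)%:E)%E.
      apply: (@le_trans _ _ (\int[nu]_u (cst e%:E u))%E).
        apply: ge0_le_integral => //.
        - by move=> u _; rewrite lee_fin.
        - by move=> u _; rewrite lee_fin.
      by rewrite integral_cst// nuT EFinM.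
    have : (\int[nu]_u (g u)%:E)%E \is a fin_num.
      by rewrite ge0_fin_numE// (le_lt_trans ie)// ltry.
    move=> /fineK Er; exists (fine (\int[nu]_u (g u)%:E)%E); split => //.
    move: i0 ie; rewrite -Er !lee_fin => i0 ie.
    have bh := bnd_itv hN.
    have lh0 : 0 <= l h by apply: l_ge0 => // x; have /andP[] := hN x.
    have lhe : l h <= e * l \1_setT.
      rewrite -lZ//; apply: l_le => //; first exact: bndZ.
      move=> x; have /andP[_] := hN x; rewrite mul1r => /le_trans; apply.
      by rewrite -[leRHS]/(e * \1_[set: T] x) indicE in_setT mulr1.
    by rewrite ler_norml; apply/andP; split; lra.
  pose A := [set x | e <= h x].
  have hN' x : 0 <= (h - e *: (\1_A : T -> R)) x <= N.+1%:R * e.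
    have -> : (h - e *: (\1_A : T -> R)) x = h x - e * (x \in A)%:R by [].
    have /andP[h0] := hN x.
    rewrite -natr1 mulrDl mul1r => hN1.
    have [ehx|hxe] := leP e (h x).
      by rewrite mem_set// mulr1; apply/andP; split; lra.
    rewrite memNset; last by rewrite /A/= leNgt hxe.
    rewrite mulr0 subr0 h0/= (le_trans (ltW hxe))//.
    by apply: ler_peMl; [exact: ltW|rewrite ler1n].
  have [r [ir lr]] := IHN _ _ hN' (stone_extendsB e A hg).
  have l1 : l h = l (h - e *: (\1_A : T -> R)) + e * l \1_A.
    rewrite -lZ// -lD ?subrK//; first exact: (bnd_itv hN').
    exact: bndZ.
  exists (r + e * l \1_A); split; last first.
    by rewrite l1 opprD addrACA subrr addr0.
  have nuA : (nu (stoneset A) = \int[nu]_u (\1_(stoneset A : set X) u)%:E)%E.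
    by rewrite integral_indic ?setIT//; exact: measurable_stoneset.
  rewrite EFinD -ir EFinM -nuE nuA.
  rewrite -ge0_integralZl//; last 2 first.
  - apply/measurable_EFinP; apply: measurable_indic; exact: measurable_stoneset.
  - by rewrite lee_fin ltW.
  rewrite -ge0_integralD//; last 4 first.
  - move=> u _; rewrite lee_fin.
    apply: (stone_extends_ge (stone_extendsB e A hg)) => x.
    by have /andP[] := hN' x.
  - apply/measurable_EFinP.
    exact: (stone_extends_measurable (stone_extendsB e A hg)).
  - by move=> u _; rewrite mule_ge0// lee_fin// ltW.
  - apply/measurable_EFinP; apply: measurable_funM => //.
    by apply: measurable_indic; exact: measurable_stoneset.
  apply: eq_integral => u _; rewrite -EFinM -EFinD; congr EFin.
  by rewrite /= subrK.
have bh := bnd_itv hM.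
have small (e : R) : 0 < e -> exists r, (\int[nu]_u (g u)%:E = r%:E)%E /\
      `|l h - r| <= e * l \1_setT.
  move=> e0; apply: (approx e (Num.truncn (M / e))) => // x.
  have /andP[-> hxM]/= := hM x.
  apply: (le_trans hxM); rewrite -ler_pdivrMr//.
  exact/ltW/truncnS_gt.
have [r [ir _]] := small 1 ltr01.
rewrite ir; congr EFin; apply/esym/eqP; rewrite -subr_eq0 -normr_le0.
apply/ler_addgt0Pl => e e0; rewrite addr0.
have l0 : 0 <= l \1_setT by apply: l_ge0 => // x; rewrite indicE.
(* The added 1 keeps the denominator positive when the total mass vanishes. *)
have d0 : 0 < e / (l \1_setT + 1) by rewrite divr_gt0// ltr_wpDl.
have [r' [ir' lr']] := small _ d0.
have rr' : r = r' by apply: EFin_inj; rewrite -ir.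
rewrite rr'; apply: (le_trans lr').
by rewrite mulrAC ler_pdivrMr ?ltr_wpDl// ler_pM2l// lerDl.
Qed.

End StoneIntegral.

Lemma stoneset_setI_ex {T : Type} (u : stone T) (A B : set T) :
  stoneset A u -> stoneset B u -> A `&` B !=set0.
Proof. by move=> uA uB; apply: (@filter_ex _ (sval u)); exact: filterI. Qed.

Lemma stoneset_setI3_ex {T : Type} (u : stone T) (A B C : set T) :
  stoneset A u -> stoneset B u -> stoneset C u -> A `&` B `&` C !=set0.
Proof.
by move=> uA uB; apply: stoneset_setI_ex; rewrite stonesetI.
Qed.

(** * The limit map from ultrafilters to points *)

Section StoneLimit.
Context {R : realType} {T : pseudoPMetricType R}.
Local Notation X := (g_sigma_algebraType (range (@stoneset T))).
Variable D : nat -> set T.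
Hypothesis hT : hausdorff_space T.
Hypothesis Dcompact : forall n, compact (D n).

(** The ultrafilters whose limit is guaranteed by compactness. Others may converge too, but they are
    left out: this set is visibly measurable and turns out to carry all the mass. *)
Definition stone_fin : set X := \bigcup_n stoneset (D n).

(* [point] when [u] contains no [D n]. *)
Definition stone_lim (u : X) : T :=
  xget point [set p : T | sval u --> p /\ stone_fin u].

Lemma stone_lim_unique (u : X) (p q : T) : sval u --> p -> sval u --> q -> p = q.
Proof.
have FF : ProperFilter (sval u) by exact: ultra_proper.
exact: (cvg_unique hT (F := sval u)).
Qed.

(** Compactness gives a limit inside [D n]; uniqueness of limits identifies it with the point picked
    by [xget]. *)
Lemma stone_limP n (u : X) : stoneset (D n) u ->
  sval u --> stone_lim u /\ D n (stone_lim u).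
Proof.
move=> uD; have := Dcompact (n := n); rewrite compact_ultra.
move=> /(_ (sval u) _ uD)[p [Dp up]].
have [ul _] : [set p : T | sval u --> p /\ stone_fin u] (stone_lim u).
  by apply: xgetPex; exists p; split => //; exists n.
by split => //; rewrite (stone_lim_unique ul up).
Qed.

Lemma measurable_stone_fin : measurable stone_fin.
Proof. by apply: bigcup_measurable => n _; exact: measurable_stoneset. Qed.

Lemma measurable_stone_lim :
  measurable_fun setT (stone_lim : X -> g_sigma_algebraType (@open T)).
Proof.
apply: (@measurability _ _ X (g_sigma_algebraType (@open T)) setT stone_lim
  (@open T)) => // _ [U oU <-]; rewrite setTI.
(* An ultrafilter containing [U] may converge to a boundary point of [U]. Containing a set that
   stays at a uniform distance inside [U] is what characterizes a limit in [U]. *)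
pose Uk k := [set x | ball x k.+1%:R^-1 `<=` U].
have finE (u : X) : stone_fin u -> U (stone_lim u) <->
    (\bigcup_k stoneset (Uk k) : set X) u.
  move=> [n _ /stone_limP[ul _]]; split.
    move=> Up; have /nbhs_ballP[e /= e0 eU] := open_nbhs_nbhs (conj oU Up).
    have [k ke] : exists k, k.+1%:R^-1 < e / 2.
      have /ltr_add_invr[k] := divr_gt0 e0 (ltr0n R 2).
      by rewrite add0r; exists k.
    exists k => //.
    have /ul : nbhs (stone_lim u) (ball (stone_lim u) k.+1%:R^-1).
      by apply: nbhsx_ballx; rewrite invr_gt0 ltr0n.
    apply: filterS => x px y xy.
    apply: eU; apply: ball_split (le_ball (ltW ke) px) (le_ball (ltW ke) xy).
  move=> [k _ uk].
  have /ul ub : nbhs (stone_lim u) (ball (stone_lim u) k.+1%:R^-1).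
    by apply: nbhsx_ballx; rewrite invr_gt0 ltr0n.
  have /filter_ex[x [/= xU px]] : sval u (Uk k `&` ball (stone_lim u) k.+1%:R^-1).
    exact: filterI.
  by apply: xU; exact: ball_sym.
have nfinE (u : X) : ~ stone_fin u -> stone_lim u = point.
  by move=> nu; apply: xgetPN => p [].
(* Off [stone_fin] the map is constantly [point], so the complement belongs to the preimage entirely
   or not at all. *)
rewrite (_ : _ @^-1` U = (stone_fin `&` \bigcup_k stoneset (Uk k)) `|`
    (if `[< U point >] then ~` stone_fin else set0)).
  apply: measurableU; first apply: measurableI.
  - exact: measurable_stone_fin.
  - by apply: bigcup_measurable => n _; exact: measurable_stoneset.
  - by case: ifP => // _; apply: measurableC; exact: measurable_stone_fin.
apply/seteqP; split => u /=.
  move=> Uu; have [fu|fu] := pselect (stone_fin u).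
    by left; split => //; exact/finE.
  by right; rewrite asboolT//= -(nfinE _ fu).
move=> [[fu /(finE u fu)//]|]; case: asboolP => // Up nfu.
by rewrite (nfinE _ nfu).
Qed.

(** The image of a closed set of ultrafilters under a continuous map, made concrete: it is the
    intersection of the closures of [D n] minus the first [k] sets [A i], hence closed in the
    compact set [D n]. *)
Lemma compact_stone_lim (A : nat -> set T) n :
  compact (stone_lim @` (stoneset (D n) `\` \bigcup_i stoneset (A i))).
Proof.
pose Ek k := D n `\` \big[setU/set0]_(i < k) A i.
have EkS k : Ek k.+1 `<=` Ek k.
  move=> x [Dx]; rewrite big_ord_recr/= => nA; split=> // Ax.
  by apply: nA; left.
have notA (u : X) k : stoneset (\big[setU/set0]_(i < k) A i) u ->
    (\bigcup_i stoneset (A i) : set X) u.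
  elim: k => [|k IHk]; first by rewrite big_ord0 => /stoneset_not0.
  by rewrite big_ord_recr/= stonesetU => -[/IHk//|uA]; exists k.
rewrite (_ : _ @` _ = \bigcap_k closure (Ek k)).
  apply: (subclosed_compact _ (Dcompact (n := n))).
    by apply: closed_bigI => k _; exact: closed_closure.
  move=> x /(_ 0%N I); rewrite /Ek big_ord0 setD0.
  by rewrite -(closure_id _).1//; exact: compact_closed.
apply/seteqP; split => [_ [u [uD uA] <-] k _|p pE].
  have [ul _] := stone_limP uD.
  have uE : sval u (Ek k).
    rewrite /Ek setDE; apply: filterI => //.
    by rewrite -[sval u _]/(stoneset _ u) stonesetC => /notA.
  by move=> V /ul uV; apply: (@filter_ex _ (sval u)); exact: filterI.
(* The shrinking balls force an ultrafilter containing every [E' k] to converge to [p]. *)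
pose E' k := Ek k `&` ball p k.+1%:R^-1.
have [||u uE'] := @stone_meet _ E'.
- move=> k x [/EkS Ex px]; split => //; apply: le_ball px.
  by rewrite lef_pV2 ?posrE ?ltr0n// ler_nat.
- move=> k; apply: (pE k I); apply: nbhsx_ballx; rewrite invr_gt0 ltr0n//.
have uE k : stoneset (Ek k) u by apply: subset_stoneset (uE' k) => x [].
have uD : stoneset (D n) u by apply: subset_stoneset (uE 0%N) => x [].
exists u; first split => //.
  move=> [k _ uA].
  have : stoneset (A k `&` Ek k.+1) u by rewrite stonesetI.
  rewrite (_ : _ `&` _ = set0) ?stoneset0// -subset0 => x [Ax [_]].
  by rewrite big_ord_recr/=; apply; right.
have [ul _] := stone_limP uD; apply: stone_lim_unique ul _.
move=> V /nbhs_ballP[e /= e0 eV].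
have [k ke] : exists k, k.+1%:R^-1 < e.
  by have /ltr_add_invr[k] := e0; rewrite add0r; exists k.
apply: filterS (uE' k) => x [_ px]; apply: eV; exact: le_ball (ltW ke) _ px.
Qed.

(** A continuous function commutes with limits along ultrafilters. The cut-off by [D n] keeps to
    ultrafilters that converge. *)
Lemma stone_lim_extends (f : T -> R) n : continuous f ->
  stone_extends (fun x => f x * \1_(D n) x)
    (fun u : X => f (stone_lim u) * \1_(stoneset (D n) : set X) u).
Proof.
move=> cf u a; have [uD|uD] := pselect (stoneset (D n) u).
  have [ul _] := stone_limP uD; rewrite indicE mem_set// mulr1.
  have fl V : nbhs (f (stone_lim u)) V -> sval u (f @^-1` V).
    by move=> fV; apply: ul; exact: cf.
  split => ua; rewrite leNgt; apply/negP => fa.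
    have /fl uV : nbhs (f (stone_lim u)) [set y | y < a].
      by apply: open_nbhs_nbhs; split => //; exact: open_lt.
    have [x [[Dx ax] /= xa]] := stoneset_setI3_ex uD ua uV.
    by move: ax; rewrite /= indicE mem_set// mulr1 leNgt xa.
  have /fl uV : nbhs (f (stone_lim u)) [set y | a < y].
    by apply: open_nbhs_nbhs; split => //; exact: open_gt.
  have [x [[Dx ax] /= xa]] := stoneset_setI3_ex uD ua uV.
  by move: ax; rewrite /= indicE mem_set// mulr1 leNgt xa.
rewrite indicE memNset// mulr0.
have {}uD : stoneset (~` D n) u by rewrite stonesetC.
split => ua; have [x [nDx]] := stoneset_setI_ex uD ua.
  by rewrite /= indicE memNset// mulr0.
by rewrite /= indicE memNset// mulr0.
Qed.

End StoneLimit.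

(** * Positive functionals on adapted spaces *)

Section AdaptedSpace.
Context {R : realType} {T : pseudoPMetricType R}.
Variables (K : set T) (D : nat -> set T) (E : set (T -> R)) (L : (T -> R) -> R).
Hypothesis hT : hausdorff_space T.
Hypothesis Dcompact : forall n, compact (D n).
Hypothesis Dincr : forall n, D n `<=` D n.+1.
Hypothesis DK : forall n, D n `<=` K.
Hypothesis E1 : E (cst 1).
Hypothesis ED : forall f g, E f -> E g -> E (f + g).
Hypothesis EZ : forall (c : R) f, E f -> E (c *: f).
Hypothesis LD : forall f g, E f -> E g -> L (f + g) = L f + L g.
Hypothesis LZ : forall (c : R) f, E f -> L (c *: f) = c * L f.
Hypothesis L_ge0 : forall f, E f -> (forall x, K x -> 0 <= f x) -> 0 <= L f.
Hypothesis E_continuous : forall f, E f -> continuous f.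
(** The second half prevents mass from escaping: relative to [g], [f] is small off a compact [D n].
    Applied to [cst 1], it also forces the [D n] to cover [K]. *)
Hypothesis E_adapted : forall f, E f -> exists2 g, E g &
  (forall x, K x -> `|f x| <= g x) /\
  forall e : R, 0 < e ->
    exists n, forall x, K x -> ~ D n x -> `|f x| <= e * g x.

Local Notation X := (g_sigma_algebraType (range (@stoneset T))).
Local Notation Y := (g_sigma_algebraType (@open T)).
Local Notation dom := (dominated_by K E).

Lemma adapted_dominated f : E f -> dom f.
Proof. by move=> /E_adapted[g Eg [fg _]]; exists g. Qed.

Lemma bounded_dominated (f : T -> R) (M : R) : (forall x, `|f x| <= M) -> dom f.
Proof.
move=> fM; exists (M *: cst 1); first exact: EZ.
by move=> x _; rewrite -[leRHS]/(M * 1) mulr1.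
Qed.

Lemma indic_dominated (A : set T) : dom (\1_A : T -> R).
Proof.
apply: (@bounded_dominated _ 1) => x.
by rewrite indicE; case: (_ \in _); rewrite ?normr1 ?normr0.
Qed.

Lemma mul_indic_dominated f (A : set T) : dom f -> dom (fun x => f x * \1_A x).
Proof.
move=> [g Eg fg]; exists g => // x Kx; apply: le_trans (fg x Kx).
by rewrite normrM indicE; case: (_ \in _);
  rewrite ?normr1 ?normr0 ?mulr1 ?mulr0.
Qed.

Let Dle m n : (m <= n)%N -> D m `<=` D n.
Proof.
elim: n => [|n IHn]; first by rewrite leqn0 => /eqP->.
rewrite leq_eqVlt => /orP[/eqP->//|/IHn h]; exact: subset_trans h (@Dincr n).
Qed.

Theorem adapted_representation :
  exists mu : {measure set Y -> \bar R},
    [/\ (mu setT < +oo)%E,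
        forall (A : set Y) (e : R), measurable A -> 0 < e ->
          exists C : set T, [/\ compact C, C `<=` A & (mu A <= mu C + e%:E)%E],
        forall A : set Y, measurable A -> A `&` K = set0 -> mu A = 0 &
        forall f, E f -> mu.-integrable setT (EFin \o f) /\
                         (\int[mu]_x (f x)%:E = (L f)%:E)%E].
Proof.
have [l [lD lZ l_ge0 lL]] := positive_functional_extension ED EZ LD LZ L_ge0
  (ex_intro _ _ E1).
have l_le f g : dom f -> dom g -> (forall x, K x -> f x <= g x) -> l f <= l g.
  move=> df dg fg; have dNf : dom (-1 *: f) by exact: dominated_byZ.
  rewrite -subr_ge0 -mulN1r -lZ// -lD//.
  apply: l_ge0; first exact: dominated_byD.
  by move=> x Kx; rewrite scaleN1r; have := fg x Kx; rewrite -subr_ge0.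
have l1_ge0 (A : set T) : 0 <= l \1_A.
  by apply: l_ge0 => [|x _]; [exact: indic_dominated|rewrite indicE].
have l1U (A B : set T) : A `&` B = set0 -> l \1_(A `|` B) = l \1_A + l \1_B.
  move=> AB; rewrite -lD; [|exact: indic_dominated..].
  congr l; apply/funext => x; rewrite -[RHS]/(\1_A x + \1_B x) !indicE in_setU.
  have [xA|xA] := boolP (x \in A); have [xB|xB] := boolP (x \in B);
    rewrite ?addr0 ?add0r//.
  by move: AB; rewrite -subset0 => /(_ x)[]; split; exact: set_mem.
have [nu [nuE nu_outer]] := stone_measure l1_ge0 l1U.
(* Off a suitable [D n] the function is at most a small multiple of [g], and [l g] is the finite
   number [L g]. For [cst 1] this shows that ultrafilters containing no [D n] form a null set. *)
have tail f (e : R) : E f -> (forall x, K x -> 0 <= f x) -> 0 < e ->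
    exists n, l (fun x => f x * \1_(~` D n) x) <= e.
  move=> Ef f0 e0; have [g Eg [fg ge]] := E_adapted Ef.
  have Lg0 : 0 <= L g.
    by apply: L_ge0 => // x Kx; apply: le_trans (fg x Kx).
  have d0 : 0 < e / (L g + 1) by rewrite divr_gt0// ltr_wpDl.
  have [n fn] := ge _ d0; exists n.
  apply: (@le_trans _ _ (l ((e / (L g + 1)) *: g))).
    apply: l_le.
    - exact/mul_indic_dominated/adapted_dominated.
    - exact/dominated_byZ/adapted_dominated.
    move=> x Kx; rewrite -[leRHS]/(_ * g x) indicE.
    have [xD|xD] := boolP (x \in ~` D n).
      by rewrite mulr1 (le_trans (ler_norm _))// fn//; exact: set_mem.
    rewrite mulr0; apply: mulr_ge0; first exact: ltW.
    by apply: le_trans (fg x Kx); exact: normr_ge0.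
  rewrite lZ ?lL//; [|exact: adapted_dominated..].
  by rewrite mulrAC ler_pdivrMr ?ltr_wpDl// ler_pM2l// lerDl.
pose phi : X -> g_sigma_algebraType (@open T) := stone_lim D.
pose C0 : set X := stone_fin D.
have mC0 : measurable C0 by exact: measurable_stone_fin.
have mphi : measurable_fun setT phi by exact: measurable_stone_lim.
have nu_tail (e : R) : 0 < e -> exists n, (nu (stoneset (~` D n)) <= e%:E)%E.
  move=> e0; have [n ln] := tail (cst 1) e E1 (fun _ _ => ler01) e0.
  exists n; rewrite nuE lee_fin; apply: le_trans ln.
  by rewrite le_eqVlt; apply/orP; left; apply/eqP; congr l; apply/funext => x;
    rewrite mul1r.
have nu0 : nu (~` C0) = 0%E.
  apply/eqP; rewrite eq_le measure_ge0 andbT; apply/lee_addgt0Pr => e e0.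
  rewrite add0e; have [n nun] := nu_tail e e0; apply: le_trans nun.
  apply: le_measure; rewrite ?inE//; [exact: measurableC|exact: measurable_stoneset|].
  by rewrite stonesetC; apply: subsetC => u uD; exists n.
have phiK u : C0 u -> K (phi u).
  by move=> [n _ /(stone_limP hT Dcompact)[_]]; exact: DK.
have mE f : E f -> measurable_fun setT (f : Y -> R).
  move=> Ef _; apply: (measurability _ (RGenOInfty.measurableE R)) => //.
  move=> /= _ [_ [a ->] <-]; rewrite setTI; apply: sub_sigma_algebra.
  have /continuousP := E_continuous Ef; apply.
  exact: interval_open.
(* Since [f] may be unbounded, [stone_integral] is applied to its cut-offs by [D n]. Both sides then
   pass to the limit: the integrals by monotone convergence, the values of [l] by [tail]. *)
have int_pos f : E f -> (forall x, K x -> 0 <= f x) ->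
    nu.-integrable setT (EFin \o (f \o phi)) /\
    (\int[nu]_u (f (phi u))%:E = (L f)%:E)%E.
  move=> Ef f0; have df := adapted_dominated Ef.
  pose h n x := f x * \1_(D n) x.
  pose g n (u : X) := f (phi u) * \1_(stoneset (D n) : set X) u.
  pose H (u : X) := f (phi u) * \1_C0 u.
  have hg n : stone_extends (h n) (g n).
    exact: (stone_lim_extends hT Dcompact n (E_continuous Ef)).
  have h0 n x : 0 <= h n x.
    rewrite /h indicE; have [/set_mem xD|_] := boolP (x \in D n).
      by rewrite mulr1; apply: f0; exact: DK xD.
    by rewrite mulr0.
  have hM n : exists M, forall x, 0 <= h n x <= M.
    have /compact_bounded[M [_ Mf]] : compact (f @` D n).
      apply: continuous_compact => //.
      by apply: continuous_subspaceT; exact: E_continuous.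
    exists (`|M| + 1) => x; rewrite h0/= /h indicE.
    have [/set_mem xD|_] := boolP (x \in D n); last by rewrite mulr0 addr_ge0.
    rewrite mulr1 (le_trans (ler_norm _))//; apply: Mf; last by exists x.
    by rewrite (le_lt_trans (ler_norm _))// ltrDl.
  have bdom f' : (exists M : R, forall x, `|f' x| <= M) -> dom f'.
    by move=> [M]; exact: bounded_dominated.
  have ig n : (\int[nu]_u (g n u)%:E = (l (h n))%:E)%E.
    have [M hMn] := hM n.
    apply: (stone_integral _ _ _ nuE hMn (hg n)).
    - by move=> f1 f2 /bdom d1 /bdom d2; exact: lD.
    - by move=> c f1 /bdom d1; exact: lZ.
    - by move=> f1 /bdom d1 f10; apply: l_ge0 => // x _.
  have g0 n u : 0 <= g n u by apply: (stone_extends_ge (hg n)) => x; exact: h0.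
  have gE n u : stoneset (D n) u -> g n u = f (phi u).
    by move=> uD; rewrite /g indicE mem_set// mulr1.
  have g_nd u m n : (m <= n)%N -> g m u <= g n u.
    move=> mn; have [uD|uD] := pselect (stoneset (D m) u).
      by rewrite !gE//; apply: subset_stoneset uD; exact: Dle.
    by rewrite [leLHS]/g indicE memNset// mulr0.
  have mg n : measurable_fun setT (fun u : X => (g n u)%:E).
    by apply/measurable_EFinP; exact: stone_extends_measurable (hg n).
  have g_cvg u : (g n u)%:E @[n --> \oo] --> (H u)%:E.
    apply: cvg_near_cst; have [[N _ uN]|uC0] := pselect (C0 u).
      near=> n; rewrite gE; last first.
        by apply: subset_stoneset uN; apply: Dle; near: n; exists N.
      by rewrite /H indicE mem_set ?mulr1//; exists N.
    near=> n; rewrite /g /H !indicE !memNset// => uD; apply: uC0.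
    by exists n.
  have lh_cvg : (l (h n))%:E @[n --> \oo] --> (L f)%:E.
    apply: cvg_EFin; first by near=> n.
    apply/cvgrPdist_le => e e0; have [N lN] := tail f e Ef f0 e0.
    near=> n.
    have dn k : dom (fun x => f x * \1_(~` D k) x).
      exact: mul_indic_dominated.
    have -> : L f - l (h n) = l (fun x => f x * \1_(~` D n) x).
      rewrite -lL//; apply/eqP; rewrite subr_eq -lD//; last first.
        exact: mul_indic_dominated.
      apply/eqP; congr l; apply/funext => x.
      rewrite -[RHS]/(f x * \1_(~` D n) x + f x * \1_(D n) x) !indicE in_setC.
      by case: (x \in D n); rewrite ?mulr1 ?mulr0 ?add0r ?addr0.
    rewrite ger0_norm; last first.
      by apply: l_ge0 => // x Kx; rewrite mulr_ge0 ?f0// indicE.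
    apply: le_trans lN; apply: l_le => // x Kx; rewrite ler_wpM2l ?f0// !indicE.
    rewrite ler_nat !in_setC.
    have [/set_mem xD|_] := boolP (x \in D N); last by rewrite leq_b1.
    by rewrite mem_set//; apply: Dle xD; near: n; exists N.
  have iH : (\int[nu]_u (H u)%:E = (L f)%:E)%E.
    rewrite (eq_integral (fun u => limn (fun n => (g n u)%:E))); last first.
      by move=> u _; apply/esym/cvg_lim.
    rewrite (monotone_convergence nu measurableT mg); last 2 first.
    - by move=> n u _; rewrite lee_fin.
    - by move=> u _ i j ij; rewrite lee_fin g_nd.
    by under eq_fun do rewrite ig; exact/cvg_lim.
  have mfphi : measurable_fun setT (f \o phi : X -> R).
    exact: measurableT_comp (mE _ Ef) mphi.
  have mH : measurable_fun setT (H : X -> R).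
    by apply: measurable_funM => //; exact: measurable_indic.
  have aeH : ae_eq nu setT (EFin \o (f \o phi)) (EFin \o H).
    exists (~` C0); split => //; first exact: measurableC.
    move=> u /= nfH C0u; apply: nfH => _.
    by rewrite /H indicE mem_set// mulr1.
  have H0 u : 0 <= H u.
    rewrite /H indicE; have [/set_mem uC|_] := boolP (u \in C0).
      by rewrite mulr1; apply: f0; exact: phiK.
    by rewrite mulr0.
  have mEH : measurable_fun setT (EFin \o H : X -> \bar R) by exact/measurable_EFinP.
  have mEf : measurable_fun setT (EFin \o (f \o phi) : X -> \bar R).
    exact/measurable_EFinP.
  split; last by rewrite -iH; apply: ae_eq_integral.
  apply/integrableP; split => //.
  rewrite (ae_eq_integral (abse \o (EFin \o H)))//.
  - under eq_integral do rewrite /= ger0_norm//.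
    by rewrite iH ltry.
  - exact: measurableT_comp.
  - exact: measurableT_comp.
  - case: aeH => N [mN N0 NH]; exists N; split => //.
    apply: subset_trans NH => u /= h1 h2; apply: h1 => _.
    exact: (congr1 abse (h2 Logic.I)).
(* The positive and negative parts of [f] may leave [E], so [f] is written as [g - (g - f)] with [g]
   its dominating element; both terms are nonnegative on [K]. *)
have int_all f : E f ->
    nu.-integrable setT (EFin \o (f \o phi)) /\
    (\int[nu]_u (f (phi u))%:E = (L f)%:E)%E.
  move=> Ef; have [g Eg [fg _]] := E_adapted Ef.
  have g0 x : K x -> 0 <= g x by move=> Kx; apply: le_trans (fg x Kx).
  have Egf : E (g - f) by rewrite -scaleN1r; apply: ED => //; exact: EZ.
  have gf0 x : K x -> 0 <= (g - f) x.
    move=> Kx; rewrite -[leRHS]/(g x - f x) subr_ge0.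
    by rewrite (le_trans (ler_norm _))// fg.
  have [ig Ig] := int_pos _ Eg g0.
  have [igf Igf] := int_pos _ Egf gf0.
  have fE : (fun u : X => (f (phi u))%:E) =
      (fun u : X => (g (phi u))%:E - ((g - f) (phi u))%:E)%E.
    apply/funext => u; rewrite -EFinB; congr EFin.
    by rewrite -[(g - f) _]/(g (phi u) - f (phi u)) opprB addrC subrK.
  split.
    rewrite -[EFin \o _]/(fun u : X => (f (phi u))%:E) fE.
    exact: integrableB.
  rewrite fE integralB_EFin// Ig Igf -EFinB; congr EFin.
  have -> : L (g - f) = L g - L f.
    have <- : L (-1 *: f) = - L f by rewrite LZ// mulN1r.
    by rewrite -LD ?scaleN1r// -scaleN1r; exact: EZ.
  by rewrite opprB addrC subrK.
pose mu : {measure set Y -> \bar R} :=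
  measure_function_pushforward__canonical__measure_function_Measure nu mphi.
have mpre A : measurable A -> measurable (phi @^-1` A).
  by move=> mA; rewrite -[X in measurable X]setTI; exact (mphi measurableT _ mA).
have nuT : (nu setT < +oo)%E by rewrite -stoneset_setT nuE ltry.
exists mu; split.
- exact: nuT.
- move=> A e mA e0.
  have e20 : 0 < e / 2 by rewrite divr_gt0.
  (* Remove from [stoneset (D N)] a clopen cover of [S] with excess mass at most [e / 2]. What
     remains lies over [A] and has compact image; the loss is the excess plus the tail beyond [D N],
     each at most [e / 2]. *)
  pose S := ~` (phi @^-1` A).
  have [B [SB sB]] := nu_outer S _ e20.
  have [N nuN] := nu_tail _ e20.
  pose V : set X := \bigcup_n stoneset (B n).
  have mV : measurable V by apply: bigcup_measurable => n _; exact: measurable_stoneset.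
  have mS : measurable S by apply: measurableC; exact: mpre.
  pose Z : set X := stoneset (D N) `\` V.
  have mZ : measurable Z by apply: measurableD => //; exact: measurable_stoneset.
  have cC : compact (phi @` Z) by exact: compact_stone_lim.
  have mC : measurable (phi @` Z : set Y).
    rewrite -[X in measurable X]setCK; apply: measurableC; apply: sub_sigma_algebra.
    by apply: closed_openC; exact: compact_closed.
  exists (phi @` Z); split => //.
    move=> _ [u [_ nVu] <-]; apply: contrapT => nA; apply: nVu.
    exact: SB.
  rewrite -[mu A]/(nu (phi @^-1` A)) -[mu (phi @` Z)]/(nu (phi @^-1` (phi @` Z))).
  have mW : measurable (V `&` phi @^-1` A) by apply: measurableI => //; exact: mpre.
  have nuW : (nu (V `&` phi @^-1` A) <= (e / 2)%:E)%E.
    have VE : V = S `|` (V `&` phi @^-1` A).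
      apply/seteqP; split => [u Vu|u [/SB//|[]//]].
      by have [uA|uA] := pselect ((phi @^-1` A) u); [right|left].
    have : (nu V <= nu S + (e / 2)%:E)%E.
      apply: le_trans sB; apply: measure_sigma_subadditive => //.
      by move=> n; exact: measurable_stoneset.
    rewrite {1}VE measureU//; last first.
      by rewrite /S setICA setICl setI0.
    rewrite leeD2lE// ge0_fin_numE//.
    by apply: le_lt_trans nuT; apply: le_measure; rewrite ?inE.
  apply: (@le_trans _ _ (nu (Z `|` ((V `&` phi @^-1` A) `|` stoneset (~` D N))))).
    apply: le_measure; rewrite ?inE.
    + exact: mpre.
    + apply: measurableU => //; apply: measurableU => //.
      exact: measurable_stoneset.
    + move=> u uA; have [uV|uV] := pselect (V u); first by right; left.
      have [uD|uD] := pselect (stoneset (D N) u); first by left.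
      by right; right; rewrite stonesetC.
  have mDN : measurable (stoneset (~` D N) : set X) by exact: measurable_stoneset.
  apply: (le_trans (measureU2 _ _ _)) => //; first exact: measurableU.
  apply: leeD.
    apply: le_measure; rewrite ?inE//; first exact: mpre.
    by move=> u Zu; exists u.
  apply: (le_trans (measureU2 _ _ _)) => //.
  by rewrite [e in leRHS]splitr EFinD leeD.
- move=> A mA AK; apply: (subset_measure0 (B := ~` C0)) nu0 => //.
  + exact: mpre.
  + exact: measurableC.
  + move=> u uA uC0; move: AK; rewrite -subset0 => /(_ (phi u)); apply.
    by split => //; exact: phiK.
- move=> f Ef; have [fi fI] := int_all _ Ef.
  have mf : measurable_fun setT (EFin \o f : Y -> \bar R).
    by apply/measurable_EFinP; exact: mE.
  split; first exact: integrable_pushforward.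
  by rewrite -fI; apply: integral_pushforward.
Unshelve. all: by end_near.
Qed.

End AdaptedSpace.

(** * Polynomials of bounded degree in the imaginary coordinates *)

Lemma big_closed {T I S : Type} (idx : S) (op : S -> S -> S)
    (P : set (T -> S)) (r : seq I) (F : I -> T -> S) :
  P (cst idx) ->
  (forall f g, P f -> P g -> P (fun x => op (f x) (g x))) ->
  (forall i, P (F i)) ->
  P (fun x => \big[op/idx]_(i <- r) F i x).
Proof.
move=> P0 Pop PF; elim: r => [|i r IHr].
  by rewrite (_ : (fun _ => _) = cst idx)//; apply/funext => x; rewrite big_nil.
rewrite (_ : (fun _ => _) =
    fun x => op (F i x) (\big[op/idx]_(j <- r) F j x)); first exact: Pop.
by apply/funext => x; rewrite big_cons.
Qed.

(** A single closure principle: a property of this kind that holds for the coordinates holds for all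
    polynomials. It is used for degree, growth and continuity, among others. *)
Definition subalgebra {R : realType} {T : Type} (P : set (T -> R)) :=
  [/\ forall c, P (cst c),
      forall f g, P f -> P g -> P (fun x => f x + g x) &
      forall f g, P f -> P g -> P (fun x => f x * g x)].

Section Subalgebra.
Context {R : realType} {T : Type} (P : set (T -> R)).
Hypothesis sP : subalgebra P.

Lemma exp_closed f k : P f -> P (fun x => f x ^+ k).
Proof.
have [Pc _ PM] := sP; move=> Pf; elim: k => [|k IHk]; first exact: (Pc 1).
rewrite (_ : (fun _ => _) = (fun x => f x * f x ^+ k)); first exact: PM.
by apply/funext => x; rewrite exprS.
Qed.

Lemma meval_closed n (v : T -> 'I_n -> R) (p : mpoly n R) :
  (forall i, P (fun x => v x i)) -> P (fun x => meval (v x) p).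
Proof.
have [Pc PD PM] := sP; move=> Pv.
rewrite (_ : (fun _ => _) = (fun x =>
    \sum_(m <- msupp p) mcoeff m p * \prod_i v x i ^+ m i)); last first.
  by apply/funext => x; rewrite mevalE.
apply: big_closed => // m; apply: (PM _ _); first exact: Pc.
apply: big_closed => // i; exact: exp_closed.
Qed.

End Subalgebra.

Section QuaternionFunctions.
Context {R : realType}.
Local Notation H := (quat R).

Lemma imag_monomial_closed (P : set (H -> R)) (a : multinom 3) :
  subalgebra P -> (forall i, P (qcoord i)) -> P (imag_monomial a).
Proof.
by move=> sP Pq; have [Pc _ PM] := sP; apply: big_closed => // i; apply: exp_closed.
Qed.

Lemma axial_fun_closed (P : set (H -> R)) (p : mpoly 2 R) :
  subalgebra P -> (forall i, P (qcoord i)) -> P (axial_fun p).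
Proof.
move=> sP Pq; have [Pc PD PM] := sP; apply: meval_closed => // i.
case: (i == ord0); first exact: Pq.
by apply: (PD _ _); [apply: (PD _ _)|]; apply: exp_closed => //; exact: Pq.
Qed.

(** The spaces of [Epoly] without an indexed family of coefficients: sums and products are then
    handled by induction on terms. Finite [k] corresponds to [d = k.+1]. *)
Inductive axial_degree_le (d : nat) : (H -> R) -> Prop :=
| axial_degree_le_term a p : (mdeg a <= d)%N ->
    axial_degree_le d (fun q => imag_monomial a q * axial_fun p q)
| axial_degree_le_add f g : axial_degree_le d f -> axial_degree_le d g ->
    axial_degree_le d (fun q => f q + g q).

Lemma imag_monomial0 q : imag_monomial mnm0 q = 1 :> R.
Proof. by apply: big1 => i _; rewrite mnm0E expr0. Qed.

Lemma imag_monomialD a b q :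
  imag_monomial (mnm_add a b) q = imag_monomial a q * imag_monomial b q :> R.
Proof.
by rewrite -big_split; apply: eq_bigr => i _; rewrite mnmDE exprD.
Qed.

Lemma imag_monomial1 i q : imag_monomial (mnm1 i) q = qcoord (lift ord0 i) q :> R.
Proof.
rewrite /imag_monomial (bigD1 i)//= mnm1E eqxx expr1 big1 ?mulr1// => j ij.
by rewrite mnm1E eq_sym (negbTE ij) expr0.
Qed.

Lemma axial_funD p p' q : axial_fun (p + p') q = axial_fun p q + axial_fun p' q :> R.
Proof. exact: mevalD. Qed.

Lemma axial_funM p p' q : axial_fun (p * p') q = axial_fun p q * axial_fun p' q :> R.
Proof. exact: mevalM. Qed.

Lemma axial_funC c q : axial_fun (mpolyC 2 c) q = c :> R.
Proof. exact: mevalC. Qed.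

Lemma axial_degree_le_axial d p : axial_degree_le d (axial_fun p).
Proof.
rewrite (_ : axial_fun p = fun q => imag_monomial mnm0 q * axial_fun p q).
  by apply: axial_degree_le_term; rewrite mdeg0.
by apply/funext => q; rewrite imag_monomial0 mul1r.
Qed.

Lemma axial_degree_leC d c : axial_degree_le d (cst c).
Proof.
rewrite (_ : cst c = axial_fun (mpolyC 2 c)); first exact: axial_degree_le_axial.
by apply/funext => q; rewrite axial_funC.
Qed.

Lemma axial_degree_leM d e f g : axial_degree_le d f -> axial_degree_le e g ->
  axial_degree_le (d + e) (fun q => f q * g q).
Proof.
elim => [a p ad|f1 f2 _ IH1 _ IH2] eg; last first.
  rewrite (_ : (fun _ => _) = fun q => f1 q * g q + f2 q * g q).
    by apply: axial_degree_le_add; [exact: IH1|exact: IH2].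
  by apply/funext => q; rewrite mulrDl.
elim: eg => [b p' be|g1 g2 _ IH1 _ IH2]; last first.
  rewrite (_ : (fun _ => _) = fun q => imag_monomial a q * axial_fun p q * g1 q
      + imag_monomial a q * axial_fun p q * g2 q).
    exact: axial_degree_le_add.
  by apply/funext => q; rewrite mulrDr.
rewrite (_ : (fun _ => _) =
    fun q => imag_monomial (mnm_add a b) q * axial_fun (p * p') q).
  by apply: axial_degree_le_term; rewrite mdegD leq_add.
by apply/funext => q; rewrite imag_monomialD axial_funM mulrACA.
Qed.

Lemma axial_degree_le_widen d e f : (d <= e)%N ->
  axial_degree_le d f -> axial_degree_le e f.
Proof.
move=> de; elim => [a p ad|f1 f2 _ IH1 _ IH2]; last exact: axial_degree_le_add.
by apply: axial_degree_le_term; exact: leq_trans de.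
Qed.

Lemma Epoly_someP k f : Epoly (Some k) f <-> axial_degree_le k.+1 f.
Proof.
split=> [[p ->]|].
  apply: (big_closed (P := axial_degree_le k.+1)) => [||a].
  - exact: axial_degree_leC.
  - exact: axial_degree_le_add.
  - by apply: axial_degree_le_term; have := bmdeg a; rewrite ltnS.
elim => [a p ad|f1 f2 _ [p1 ->] _ [p2 ->]]; last first.
  exists (fun a => p1 a + p2 a); apply/funext => q.
  by rewrite -big_split; apply: eq_bigr => a _; rewrite axial_funD mulrDr.
exists (fun b => if b == a :> multinom 3 then p else 0).
apply/funext => q; rewrite (bigD1 (@BMultinom 3 k.+2 a ad))//= eqxx big1 ?addr0//.
move=> b; rewrite -val_eqE/= => /negbTE ->.
by rewrite /axial_fun meval0 mulr0.
Qed.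

Lemma subalgebra_axial : subalgebra [set f | exists d, axial_degree_le d f].
Proof.
split=> [c|f g [d df] [e eg]|f g [d df] [e eg]].
- by exists 0%N; exact: axial_degree_leC.
- exists (maxn d e); apply: axial_degree_le_add.
    by apply: axial_degree_le_widen df; exact: leq_maxl.
  by apply: axial_degree_le_widen eg; exact: leq_maxr.
- by exists (d + e)%N; exact: axial_degree_leM.
Qed.

Lemma qcoord0_axial q : axial_fun (mpolyX R (mnm1 ord0)) q = q0 q.
Proof. by rewrite /axial_fun mevalXU eqxx. Qed.

Lemma axial_degree_le_q0 d : axial_degree_le d q0.
Proof.
rewrite (_ : q0 = axial_fun (mpolyX R (mnm1 ord0))).
  exact: axial_degree_le_axial.
by apply/funext => q; rewrite qcoord0_axial.
Qed.

Lemma axial_degree_le_coord_mul i p :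
  axial_degree_le 1 (fun q => axial_fun p q * qcoord (lift ord0 i) q).
Proof.
rewrite (_ : (fun _ => _) = fun q => imag_monomial (mnm1 i) q * axial_fun p q).
  by apply: axial_degree_le_term; rewrite mdeg1.
by apply/funext => q; rewrite imag_monomial1 mulrC.
Qed.

Lemma axial_degree_le_qcoord i : axial_degree_le 1 (qcoord i).
Proof.
case: (unliftP ord0 i) => [j|] ->.
  rewrite (_ : qcoord _ = fun q => axial_fun 1 q * qcoord (lift ord0 j) q).
    exact: axial_degree_le_coord_mul.
  by apply/funext => q; rewrite /axial_fun meval1 mul1r.
rewrite (_ : qcoord _ = q0); first exact: axial_degree_le_q0.
by apply/funext => q; rewrite /q0; congr qcoord; exact: val_inj.
Qed.

Lemma subalgebra_poly4 : subalgebra (range (@poly4_fun R)).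
Proof.
split=> [c|_ _ [p _ <-] [p' _ <-]|_ _ [p _ <-] [p' _ <-]].
- by exists (mpolyC 4 c) => //; apply/funext => q; exact: mevalC.
- by exists (p + p') => //; apply/funext => q; exact: mevalD.
- by exists (p * p') => //; apply/funext => q; exact: mevalM.
Qed.

Lemma poly4_qcoord i : range (@poly4_fun R) (qcoord i).
Proof.
by exists (mpolyX R (mnm1 i)) => //; apply/funext => q; exact: mevalXU.
Qed.

(** Every coordinate has degree at most 1 and degrees add under products, so the union over [d] is
    the whole polynomial ring. *)
Lemma Epoly_noneP f : Epoly None f <-> exists d, axial_degree_le d f.
Proof.
split=> [[p _ <-]|[d]].
  apply: (meval_closed subalgebra_axial) => i.
  by exists 1%N; exact: axial_degree_le_qcoord.
have [_ PD PM] := subalgebra_poly4.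
elim => [a p ad|f1 f2 _ IH1 _ IH2]; last exact: PD.
apply: PM; [apply: imag_monomial_closed|apply: axial_fun_closed];
  by [exact: subalgebra_poly4 | exact: poly4_qcoord].
Qed.

Lemma EpolyD k (f g : H -> R) : Epoly k f -> Epoly k g -> Epoly k (f + g).
Proof.
case: k => [k|].
  move=> /Epoly_someP fE /Epoly_someP gE; apply/Epoly_someP.
  exact: axial_degree_le_add.
move=> /Epoly_noneP fE /Epoly_noneP gE; apply/Epoly_noneP.
by have [_ PD _] := subalgebra_axial; exact: PD.
Qed.

Lemma EpolyZ k (c : R) (f : H -> R) : Epoly k f -> Epoly k (c *: f).
Proof.
case: k => [k|].
  move=> /Epoly_someP fE; apply/Epoly_someP.
  exact: (axial_degree_leM (axial_degree_leC 0 c) fE).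
move=> /Epoly_noneP fE; apply/Epoly_noneP.
have [Pc _ PM] := subalgebra_axial; exact: (PM _ _ (Pc c) fE).
Qed.

Lemma Epoly_axial k (p : mpoly 2 R) : Epoly k (axial_fun p).
Proof.
case: k => [k|]; first exact/Epoly_someP/axial_degree_le_axial.
by apply/Epoly_noneP; exists 0%N; exact: axial_degree_le_axial.
Qed.

Lemma Epoly_closed k (P : set (H -> R)) f :
  subalgebra P -> (forall i, P (qcoord i)) -> Epoly k f -> P f.
Proof.
move=> sP Pq.
have aux d : axial_degree_le d f -> P f.
  have [_ PD PM] := sP; elim => [a p ad|f1 f2 _ IH1 _ IH2]; last exact: PD.
  by apply: PM; [apply: imag_monomial_closed|apply: axial_fun_closed].
by case: k => [k /Epoly_someP/aux//|/Epoly_noneP[d /aux]].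
Qed.

Definition qnorm2 (q : H) : R := q0 q ^+ 2 + (q1 q ^+ 2 + q2 q ^+ 2 + q3 q ^+ 2).

Lemma qnorm2_ge0 q : 0 <= qnorm2 q.
Proof. by rewrite !addr_ge0 ?sqr_ge0. Qed.

(** The weights that make the space adapted have degree 0 in the imaginary coordinates, hence belong
    to [Epoly k] for every [k]. *)
Lemma qnorm2_axial m : exists p : mpoly 2 R,
  axial_fun p = fun q => (1 + qnorm2 q) ^+ m.
Proof.
exists ((1 + mpolyX R (mnm1 ord0) ^+ 2 + mpolyX R (mnm1 ord_max)) ^+ m).
apply/funext => q.
have aX (p : mpoly 2 R) j : axial_fun (p ^+ j) q = axial_fun p q ^+ j.
  by rewrite /axial_fun rmorphXn.
rewrite aX !axial_funD aX qcoord0_axial /axial_fun meval1 mevalXU /=.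
by rewrite /qnorm2 !addrA.
Qed.

Lemma subalgebra_growth : subalgebra
  [set f : H -> R | exists C m, 0 <= C /\ forall q, `|f q| <= C * (1 + qnorm2 q) ^+ m].
Proof.
have N1 q : 1 <= 1 + qnorm2 q by rewrite lerDl qnorm2_ge0.
have N0 q m : 0 <= (1 + qnorm2 q) ^+ m by rewrite exprn_ge0// (le_trans ler01).
split=> [c|f g [C [m [C0 fC]]] [C' [m' [C'0 gC']]]|
  f g [C [m [C0 fC]]] [C' [m' [C'0 gC']]]].
- by exists `|c|, 0%N; split => // q; rewrite expr0 mulr1.
- exists (C + C'), (m + m')%N; split; first exact: addr_ge0.
  move=> q; rewrite mulrDl (le_trans (ler_normD _ _))// lerD//.
    by rewrite (le_trans (fC q))// ler_wpM2l// exprD ler_peMr// exprn_ege1.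
  by rewrite (le_trans (gC' q))// ler_wpM2l// exprD ler_peMl// exprn_ege1.
- exists (C * C'), (m + m')%N; split; first exact: mulr_ge0.
  by move=> q; rewrite normrM exprD mulrACA ler_pM.
Qed.

Lemma qcoord_sqr_le i (q : H) : qcoord i q ^+ 2 <= qnorm2 q.
Proof.
have s0 := sqr_ge0 (q0 q); have s1 := sqr_ge0 (q1 q).
have s2 := sqr_ge0 (q2 q); have s3 := sqr_ge0 (q3 q).
have : [\/ qcoord i q = q0 q, qcoord i q = q1 q,
    qcoord i q = q2 q | qcoord i q = q3 q].
  by case: i => -[|[|[|[|//]]]] hi; [apply: Or41|apply: Or42|apply: Or43|apply: Or44];
    congr qcoord; exact: val_inj.
by rewrite /qnorm2 => -[]->; lra.
Qed.

Lemma qcoord_growth i : exists C m, 0 <= C /\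
  forall q : H, `|qcoord i q| <= C * (1 + qnorm2 q) ^+ m.
Proof.
exists 1, 1%N; split => // q; rewrite mul1r expr1.
have := qcoord_sqr_le i q.
rewrite -real_normK ?num_real// => h.
(* From (|x| - 1)^2 >= 0 follows |x| <= 1 + x^2, which avoids square roots. *)
have := sqr_ge0 (`|qcoord i q| - 1); nra.
Qed.

Lemma Epoly_growth k f : Epoly k f -> exists C m, 0 <= C /\
  forall q : H, `|f q| <= C * (1 + qnorm2 q) ^+ m.
Proof.
exact: Epoly_closed subalgebra_growth qcoord_growth.
Qed.

Lemma subalgebra_continuous : subalgebra [set f : 'rV[R]_4 -> R | continuous f].
Proof.
split=> [c|f g /= cf cg x|f g /= cf cg x].
- by move=> x; apply: cst_continuous.
- by apply: continuousD; [exact: cf|exact: cg].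
- by apply: continuousM; [exact: cf|exact: cg].
Qed.

Lemma qcoord_continuous i : continuous (@qcoord R i : 'rV[R]_4 -> R).
Proof. exact: coord_continuous. Qed.

Lemma Epoly_continuous k f : Epoly k f -> continuous (f : 'rV[R]_4 -> R).
Proof. exact: Epoly_closed subalgebra_continuous qcoord_continuous. Qed.

End QuaternionFunctions.

(** * From words to real polynomials: degrees of the coordinates *)

Section Coordinates.
Context {R : realType}.
Local Notation H := (quat R).

Definition qaxial_degree_le (d : nat) (F : H -> H) : Prop :=
  [/\ axial_degree_le d (fun q => q0 (F q)), axial_degree_le d (fun q => q1 (F q)),
      axial_degree_le d (fun q => q2 (F q)) & axial_degree_le d (fun q => q3 (F q))].

Lemma qaxial_degree_leC (c : H) : qaxial_degree_le 0 (cst c).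
Proof. by split; exact: axial_degree_leC. Qed.

Lemma qaxial_degree_leD d F G : qaxial_degree_le d F -> qaxial_degree_le d G ->
  qaxial_degree_le d (fun q => F q + G q).
Proof.
move=> [F0 F1 F2 F3] [G0 G1 G2 G3]; split.
- by under eq_fun do rewrite q0D; exact: axial_degree_le_add.
- by under eq_fun do rewrite q1D; exact: axial_degree_le_add.
- by under eq_fun do rewrite q2D; exact: axial_degree_le_add.
- by under eq_fun do rewrite q3D; exact: axial_degree_le_add.
Qed.

Lemma axial_degree_leB d (f g : H -> R) : axial_degree_le d f -> axial_degree_le d g ->
  axial_degree_le d (fun q => f q - g q).
Proof.
move=> fd gd.
rewrite (_ : (fun _ => _) = fun q => f q + (cst (-1) q * g q)).
  apply: axial_degree_le_add => //.
  exact: (axial_degree_leM (axial_degree_leC 0 (-1)) gd).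
by apply/funext => q; rewrite mulN1r.
Qed.

Lemma qaxial_degree_leM d e F G : qaxial_degree_le d F -> qaxial_degree_le e G ->
  qaxial_degree_le (d + e) (fun q => F q * G q).
Proof.
move=> [F0 F1 F2 F3] [G0 G1 G2 G3].
have M f g := @axial_degree_leM R d e f g.
have D f g := @axial_degree_le_add R (d + e) f g.
have B f g := @axial_degree_leB (d + e) f g.
split.
- rewrite (_ : (fun _ => _) = fun q => q0 (F q) * q0 (G q) - q1 (F q) * q1 (G q)
    - q2 (F q) * q2 (G q) - q3 (F q) * q3 (G q)).
    by apply: (B _ _) (M _ _ F3 G3); apply: (B _ _) (M _ _ F2 G2);
       exact: (B _ _ (M _ _ F0 G0) (M _ _ F1 G1)).
  by apply/funext => q; rewrite q0E.
- rewrite (_ : (fun _ => _) = fun q => q0 (F q) * q1 (G q) + q1 (F q) * q0 (G q)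
    + q2 (F q) * q3 (G q) - q3 (F q) * q2 (G q)).
    by apply: (B _ _) (M _ _ F3 G2); apply: (D _ _) (M _ _ F2 G3);
       exact: (D _ _ (M _ _ F0 G1) (M _ _ F1 G0)).
  by apply/funext => q; rewrite q1E.
- rewrite (_ : (fun _ => _) = fun q => q0 (F q) * q2 (G q) - q1 (F q) * q3 (G q)
    + q2 (F q) * q0 (G q) + q3 (F q) * q1 (G q)).
    by apply: (D _ _) (M _ _ F3 G1); apply: (D _ _) (M _ _ F2 G0);
       exact: (B _ _ (M _ _ F0 G2) (M _ _ F1 G3)).
  by apply/funext => q; rewrite q2E.
- rewrite (_ : (fun _ => _) = fun q => q0 (F q) * q3 (G q) + q1 (F q) * q2 (G q)
    - q2 (F q) * q1 (G q) + q3 (F q) * q0 (G q)).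
    by apply: (D _ _) (M _ _ F3 G0); apply: (B _ _) (M _ _ F2 G1);
       exact: (D _ _ (M _ _ F0 G3) (M _ _ F1 G2)).
  by apply/funext => q; rewrite q3E.
Qed.

Lemma qaxial_degree_le_prod k (F : 'I_k -> H -> H) :
  (forall i, qaxial_degree_le 1 (F i)) ->
  qaxial_degree_le k (fun q => \prod_(i < k) F i q).
Proof.
elim: k F => [|k IHk] F Fi.
  by under eq_fun do rewrite big_ord0; exact: qaxial_degree_leC.
under eq_fun do rewrite big_ord_recl.
by apply: (qaxial_degree_leM (Fi _)); exact: IHk.
Qed.

(* [(Im q)^2] is minus the squared norm of [Im q], so [A + B Im q] with [A], [B]
   axial is stable under multiplication by [q] and [qconj q]. *)
Lemma qpow_axial m n : exists A B : mpoly 2 R, forall q : H,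
  qconj q ^+ m * q ^+ n = mkquat (axial_fun A q) (axial_fun B q * q1 q)
    (axial_fun B q * q2 q) (axial_fun B q * q3 q).
Proof.
pose X0 : mpoly 2 R := mpolyX R (mnm1 ord0).
pose X1 : mpoly 2 R := mpolyX R (mnm1 ord_max).
have X1E q : axial_fun X1 q = q1 q ^+ 2 + q2 q ^+ 2 + q3 q ^+ 2.
  by rewrite /axial_fun mevalXU.
have aN (p : mpoly 2 R) q : axial_fun (- p) q = - axial_fun p q by exact: mevalN.
elim: n => [|n [A [B AB]]]; last first.
  (* With v = Im q and v^2 = -|v|^2, the product (A + B v)(x0 + v) is (A x0 - B |v|^2) + (A + B x0)
     v. The witnesses for [qconj q] below come from x0 - v in the same way. *)
  exists (A * X0 - B * X1), (A + B * X0) => q.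
  rewrite exprSr mulrA AB; apply: quatP;
    rewrite !qE !(axial_funD, axial_funM, aN) ?qcoord0_axial ?X1E; ring.
elim: m => [|m [A [B AB]]].
  exists 1, 0 => q; rewrite !expr0 mulr1 /axial_fun meval1 meval0 !mul0r.
  exact: quatP.
exists (A * X0 + B * X1), (B * X0 - A) => q.
rewrite expr0 mulr1 exprSr -[qconj q ^+ m]mulr1 -[in LHS](expr0 q) AB.
apply: quatP; rewrite !qE !(axial_funD, axial_funM, aN) ?qcoord0_axial ?X1E; ring.
Qed.

Lemma q1_lift (q : H) : q1 q = qcoord (lift ord0 (@Ordinal 3 0 isT)) q.
Proof. by congr (qcoord _ q); exact: val_inj. Qed.

Lemma q2_lift (q : H) : q2 q = qcoord (lift ord0 (@Ordinal 3 1 isT)) q.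
Proof. by congr (qcoord _ q); exact: val_inj. Qed.

Lemma q3_lift (q : H) : q3 q = qcoord (lift ord0 (@Ordinal 3 2 isT)) q.
Proof. by congr (qcoord _ q); exact: val_inj. Qed.

Lemma qaxial_degree_le_pow m n :
  qaxial_degree_le 1 (fun q : H => qconj q ^+ m * q ^+ n).
Proof.
have [A [B AB]] := qpow_axial m n; under eq_fun do rewrite AB.
split.
- under eq_fun do rewrite q0E; exact: axial_degree_le_axial.
- under eq_fun do rewrite q1E q1_lift; exact: axial_degree_le_coord_mul.
- under eq_fun do rewrite q2E q2_lift; exact: axial_degree_le_coord_mul.
- under eq_fun do rewrite q3E q3_lift; exact: axial_degree_le_coord_mul.
Qed.

(** The leading block and each of the [k] factors letter-times-block have degree at most 1;
    constants on either side add nothing. *)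
Lemma qaxial_degree_le_Hpoly k (F : H -> H) : Hpoly_fin k F ->
  qaxial_degree_le k.+1 F.
Proof.
move=> [N [a [b [g [gw ->]]]]].
have word i : qaxial_degree_le k.+1 (g i).
  have [m [n [s [_ ->]]]] := gw i.
  apply: (@qaxial_degree_leM 1 k); first exact: qaxial_degree_le_pow.
  apply: qaxial_degree_le_prod => j.
  under eq_fun do rewrite -mulrA.
  apply: (@qaxial_degree_leM 0 1); first exact: qaxial_degree_leC.
  exact: qaxial_degree_le_pow.
apply: (big_closed (P := qaxial_degree_le k.+1)) => [||i].
- by split; exact: axial_degree_leC.
- exact: qaxial_degree_leD.
- have := qaxial_degree_leM (qaxial_degree_leM (qaxial_degree_leC (a i)) (word i))
    (qaxial_degree_leC (b i)).
  by rewrite add0n addn0.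
Qed.

Theorem Hpoly_coord_Epoly k (F : H -> H) i : Hpoly k F ->
  Epoly k (fun q => qcoord i (F q)).
Proof.
have aux d : qaxial_degree_le d F -> axial_degree_le d (fun q => qcoord i (F q)).
  move=> [F0 F1 F2 F3].
  have [->|->|->|->] : [\/ qcoord i = @q0 R, qcoord i = @q1 R,
      qcoord i = @q2 R | qcoord i = @q3 R].
    by case: i => -[|[|[|[|//]]]] hi; [apply: Or41|apply: Or42|apply: Or43|apply: Or44];
      apply/funext => q; congr (qcoord _ q); exact: val_inj.
  - by [].
  - by [].
  - by [].
  - by [].
case: k => [k /qaxial_degree_le_Hpoly/aux/Epoly_someP//|].
move=> [k _ /qaxial_degree_le_Hpoly/aux Fd].
by apply/Epoly_noneP; exists k.+1.
Qed.

End Coordinates.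

(** * From real polynomials to words *)

Section HPolynomials.
Context {R : realType}.
Local Notation H := (quat R).

Lemma qreal_comm (x : R) (p : H) : qreal x * p = p * qreal x.
Proof. by apply: quatP; rewrite !qE; ring. Qed.

Lemma qrealD (x y : R) : qreal (x + y) = qreal x + qreal y.
Proof. by apply: quatP; rewrite !(qD, qE) ?addr0. Qed.

Lemma qrealM (x y : R) : qreal (x * y) = qreal x * qreal y.
Proof. by apply: quatP; rewrite !qE; ring. Qed.

Lemma quat_basis (p : H) : p = qreal (q0 p) * 1 + qreal (q1 p) * qi +
  qreal (q2 p) * qj + qreal (q3 p) * qk.
Proof. by rewrite mulr1; apply: quatP; rewrite !(qD, qE); ring. Qed.

(** Serves to replace a constant caught between two words by the letters of [qSigma]; the factor 1
    stays visible because it is one of those letters. *)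
Lemma quat_mul_basis (a v e z : H) : a * (v * (e * z)) =
  a * (v * (qreal (q0 e) * 1 * z)) + a * (v * (qreal (q1 e) * qi * z)) +
  a * (v * (qreal (q2 e) * qj * z)) + a * (v * (qreal (q3 e) * qk * z)).
Proof.
rewrite {1}(quat_basis e); move: (qreal _ * 1) (qreal _ * qi) => e0 e1.
by move: (qreal _ * qj) (qreal _ * qk) => e2 e3; rewrite !mulrDl !mulrDr.
Qed.

Lemma Hspan_gen (F : set (H -> H)) (a b : H) g : F g ->
  Hspan F (fun q => a * g q * b).
Proof.
move=> Fg; exists 1%N, (fun=> a), (fun=> b), (fun=> g); split => //.
by apply/funext => q; rewrite big_ord1.
Qed.

Lemma Hspan0 (F : set (H -> H)) : Hspan F (cst 0).
Proof.
exists 0%N, (fun=> 0), (fun=> 0), (fun=> cst 0); split; first by case.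
by apply/funext => q; rewrite big_ord0.
Qed.

Lemma HspanD (F : set (H -> H)) f g : Hspan F f -> Hspan F g ->
  Hspan F (fun q => f q + g q).
Proof.
move=> [n [a [b [u [Fu ->]]]]] [m [c [d [v [Fv ->]]]]].
pose sel S (x : 'I_n -> S) (y : 'I_m -> S) (i : 'I_(n + m)) :=
  match fintype.split i with inl j => x j | inr j => y j end.
exists (n + m)%N, (sel _ a c), (sel _ b d), (sel _ u v); split.
  by move=> i; rewrite /sel; case: fintype.split.
apply/funext => q; rewrite big_split_ord /sel.
by congr (_ + _); apply: eq_bigr => i _; rewrite ?(unsplitK (inl i)) ?(unsplitK (inr i)).
Qed.

Lemma HspanM (F : set (H -> H)) (a b : H) f : Hspan F f ->
  Hspan F (fun q => a * f q * b).
Proof.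
move=> [n [c [d [u [Fu ->]]]]].
exists n, (fun i => a * c i), (fun i => d i * b), u; split => //.
apply/funext => q; rewrite mulr_sumr mulr_suml.
by apply: eq_bigr => i _; rewrite !mulrA.
Qed.

Lemma Hword_cons k (m1 n1 : 'I_1 -> nat) s1 (m n : 'I_k.+1 -> nat) s (c : H) :
  qSigma c -> (forall i, qSigma (s i)) ->
  exists m' n' s', (forall i, qSigma (s' i)) /\
    (fun q => Hword m1 n1 s1 q * c * Hword m n s q) = @Hword R k.+1 m' n' s'.
Proof.
move=> Sc Ss.
exists (fun i => if unlift ord0 i is Some j then m j else m1 ord0).
exists (fun i => if unlift ord0 i is Some j then n j else n1 ord0).
exists (fun i => if unlift ord0 i is Some j then s j else c); split.
  by move=> i; case: unliftP => [j _|_].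
apply/funext => q; rewrite /Hword big_ord0 mulr1 !big_ord_recl.
rewrite !unlift_none !liftK !mulrA; congr (_ * _).
by apply: eq_bigr => i _; rewrite !liftK.
Qed.

(** The constant [b i * c j] between two words is expanded over 1, i, j, k. Its real coefficients
    are central and move to the left, and the basis element becomes the one additional letter. *)
Lemma Hpoly_finM k (f g : H -> H) : Hpoly_fin 0 f -> Hpoly_fin k g ->
  Hpoly_fin k.+1 (fun q => f q * g q).
Proof.
move=> [N [a [b [v [vw ->]]]]] [M [c [d [w [ww ->]]]]].
under eq_fun do rewrite mulr_suml.
apply: (big_closed (P := Hpoly_fin k.+1)) => [||i];
  [exact: Hspan0|exact: HspanD|].
under eq_fun do rewrite mulr_sumr.
apply: (big_closed (P := Hpoly_fin k.+1)) => [||j];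
  [exact: Hspan0|exact: HspanD|].
have term (x : R) (s : H) : qSigma s ->
    Hpoly_fin k.+1 (fun q => a i * qreal x * (v i q * s * w j q) * d j).
  move=> Ss; apply: Hspan_gen.
  have [m1 [n1 [s1 [_ ->]]]] := vw i; have [m [n [t [tS ->]]]] := ww j.
  have [m' [n' [s' [sS' E]]]] := Hword_cons m1 n1 s1 m n Ss tS.
  by exists m', n', s'; split.
rewrite (_ : (fun _ => _) = fun q =>
  a i * qreal (q0 (b i * c j)) * (v i q * 1 * w j q) * d j +
  a i * qreal (q1 (b i * c j)) * (v i q * qi * w j q) * d j +
  a i * qreal (q2 (b i * c j)) * (v i q * qj * w j q) * d j +
  a i * qreal (q3 (b i * c j)) * (v i q * qk * w j q) * d j).
  do 3?[apply: HspanD]; apply: term; rewrite /qSigma/=; tauto.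
apply/funext => q.
have key x (s : H) : a i * qreal x * (v i q * s * w j q) * d j =
    a i * (v i q * (qreal x * s * (w j q * d j))).
  by rewrite !mulrA -(mulrA (a i)) qreal_comm !mulrA.
transitivity (a i * (v i q * (b i * c j * (w j q * d j)))); first by rewrite !mulrA.
by rewrite quat_mul_basis; do 3?[congr (_ + _)]; rewrite key.
Qed.

Lemma Hpoly_finS k (f : H -> H) : Hpoly_fin k f -> Hpoly_fin k.+1 f.
Proof.
move=> fk; rewrite (_ : f = fun q => (1 * 1 * 1) * f q); last first.
  by apply/funext => q; rewrite !mul1r.
apply: (Hpoly_finM (f := fun=> 1 * 1 * 1)) => //.
apply: (@Hspan_gen _ 1 1 (fun=> 1)).
exists (fun=> 0%N), (fun=> 0%N), (fun=> 1); split; first by case.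
by apply/funext => q; rewrite /Hword big_ord0 !expr0 !mulr1.
Qed.

Lemma Hpoly_fin_widen k l (f : H -> H) : (k <= l)%N -> Hpoly_fin k f -> Hpoly_fin l f.
Proof.
elim: l => [|l IHl]; first by rewrite leqn0 => /eqP->.
by rewrite leq_eqVlt => /orP[/eqP->//|/IHl h /h]; exact: Hpoly_finS.
Qed.

(** With real coefficients a product costs no letter, because reals are central and [q] commutes
    with [qconj q]. This gives an algebra inside [Hpoly_fin 0]. *)
Inductive qqconj_rpoly : (H -> H) -> Prop :=
| qqconj_rpoly_term c m n : qqconj_rpoly (fun q => qreal c * (qconj q ^+ m * q ^+ n))
| qqconj_rpoly_add f g : qqconj_rpoly f -> qqconj_rpoly g ->
    qqconj_rpoly (fun q => f q + g q).

Lemma qconj_comm (q : H) : GRing.comm (qconj q) q.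
Proof. by apply: quatP; rewrite !qE; ring. Qed.

Lemma qqconj_rpolyM f g : qqconj_rpoly f -> qqconj_rpoly g ->
  qqconj_rpoly (fun q => f q * g q).
Proof.
elim => [c m n|f1 f2 _ IH1 _ IH2] gP; last first.
  by under eq_fun do rewrite mulrDl; apply: qqconj_rpoly_add; [exact: IH1|exact: IH2].
elim: gP => [c' m' n'|g1 g2 _ IH1 _ IH2]; last first.
  by under eq_fun do rewrite mulrDr; exact: qqconj_rpoly_add.
rewrite (_ : (fun _ => _) =
    fun q => qreal (c * c') * (qconj q ^+ (m + m') * q ^+ (n + n'))).
  exact: qqconj_rpoly_term.
apply/funext => q; rewrite qrealM !exprD.
have C : q ^+ n * qconj q ^+ m' = qconj q ^+ m' * q ^+ n.
  by apply: commrX; apply: commr_sym; apply: commrX; exact: qconj_comm.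
rewrite -!mulrA; congr (_ * _); rewrite [in RHS]mulrA.
rewrite (mulrA (q ^+ n)) -(qreal_comm c' (q ^+ n)) !mulrA.
rewrite -(qreal_comm c' (qconj q ^+ m)) -!mulrA; congr (_ * (_ * _)).
by rewrite !mulrA C.
Qed.

Lemma qqconj_rpoly_id : qqconj_rpoly id.
Proof.
rewrite (_ : id = fun q => qreal 1 * (qconj q ^+ 0 * q ^+ 1)).
  exact: qqconj_rpoly_term.
by apply/funext => q; rewrite expr0 expr1 !mul1r.
Qed.

Lemma qqconj_rpoly_conj : qqconj_rpoly qconj.
Proof.
rewrite (_ : qconj = fun q => qreal 1 * (qconj q ^+ 1 * q ^+ 0)).
  exact: qqconj_rpoly_term.
by apply/funext => q; rewrite expr0 expr1 mulr1 !mul1r.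
Qed.

Lemma qqconj_rpolyC c : qqconj_rpoly (fun=> qreal c).
Proof.
rewrite (_ : (fun _ => _) = fun q => qreal c * (qconj q ^+ 0 * q ^+ 0)).
  exact: qqconj_rpoly_term.
by apply/funext => q; rewrite !expr0 !mulr1.
Qed.

(** Both variables are available: x0 is ([qconj q] + q) / 2, and |Im q|^2 is [qconj q * q] minus
    x0^2. *)
Lemma qqconj_rpoly_axial p : qqconj_rpoly (fun q => qreal (axial_fun p q)).
Proof.
pose P := [set f : H -> R | qqconj_rpoly (fun q => qreal (f q))].
have sP : subalgebra P.
  rewrite /P; split=> [c|f g /= fP gP|f g /= fP gP]; first exact: qqconj_rpolyC.
    by under eq_fun do rewrite qrealD; exact: qqconj_rpoly_add.
  by under eq_fun do rewrite qrealM; exact: qqconj_rpolyM.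
have q0P : qqconj_rpoly (fun q => qreal (q0 q)).
  rewrite (_ : (fun _ => _) = fun q => qreal 2^-1 * (qconj q + q)).
    apply: (qqconj_rpolyM (f := fun=> _)); first exact: qqconj_rpolyC.
    by apply: qqconj_rpoly_add; [exact: qqconj_rpoly_conj|exact: qqconj_rpoly_id].
  apply/funext => q; apply: quatP; rewrite !(qE, qD) ?qE; by field.
suff : P (axial_fun p) by [].
rewrite /axial_fun; apply: (@meval_closed R H P sP 2) => i.
rewrite /P /=; case: (i == ord0) => //.
rewrite (_ : (fun _ => _) = fun q => qconj q * q +
    qreal (-1) * (qreal (q0 q) * qreal (q0 q))).
  apply: qqconj_rpoly_add.
    by apply: qqconj_rpolyM; [exact: qqconj_rpoly_conj|exact: qqconj_rpoly_id].
  apply: (qqconj_rpolyM (f := fun=> _)); first exact: qqconj_rpolyC.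
  exact: (qqconj_rpolyM q0P q0P).
by apply/funext => q; apply: quatP; rewrite !(qE, qD) ?qE; ring.
Qed.

Lemma Hpoly_fin0_rpoly (a b : H) F : qqconj_rpoly F ->
  Hpoly_fin 0 (fun q => a * F q * b).
Proof.
elim => [c m n|f g _ IH1 _ IH2]; last first.
  by under eq_fun do rewrite mulrDr mulrDl; exact: HspanD.
under eq_fun do rewrite (mulrA a).
apply: Hspan_gen.
exists (fun=> m), (fun=> n), (fun=> 1); split; first by case.
by apply/funext => q; rewrite /Hword big_ord0 mulr1.
Qed.

Lemma Hpoly_fin0_axial p : Hpoly_fin 0 (fun q : H => qreal (axial_fun p q)).
Proof.
have := Hpoly_fin0_rpoly 1 1 (qqconj_rpoly_axial p).
by under eq_fun do rewrite mul1r mulr1.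
Qed.

(* [2 x_l = e (qconj q) - q e] for [e] the [l]-th imaginary unit. *)
Lemma Hpoly_fin0_axial_coord i p :
  Hpoly_fin 0 (fun q : H => qreal (axial_fun p q * qcoord (lift ord0 i) q)).
Proof.
have key (e : H) (x : H -> R) :
    (forall q, qreal (x q) = qreal 2^-1 * (e * qconj q) + qreal (- 2^-1) * (q * e)) ->
    Hpoly_fin 0 (fun q : H => qreal (axial_fun p q * x q)).
  move=> xE.
  rewrite (_ : (fun _ => _) = fun q =>
    (qreal 2^-1 * e) * (qreal (axial_fun p q) * qconj q) * 1 +
    qreal (- 2^-1) * (qreal (axial_fun p q) * q) * e).
    apply: HspanD; apply: Hpoly_fin0_rpoly; apply: qqconj_rpolyM;
      by [exact: qqconj_rpoly_axial|exact: qqconj_rpoly_conj|exact: qqconj_rpoly_id].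
  apply/funext => q; rewrite qrealM xE mulrDr mulr1; congr (_ + _).
    by rewrite -!mulrA qreal_comm -!mulrA; congr (_ * (_ * _)); rewrite qreal_comm.
  have := qreal_comm (axial_fun p q) (qreal (- 2^-1)).
  move: (qreal (axial_fun p q)) (qreal (- 2^-1)) => P c Pc.
  by rewrite !mulrA Pc.
case: i => -[|[|[|//]]] hi.
- apply: (key qi) => q.
  rewrite (_ : qcoord _ q = q1 q); last by congr (qcoord _ q); exact: val_inj.
  apply: quatP; rewrite !(qE, qD) ?qE; by field.
- apply: (key qj) => q.
  rewrite (_ : qcoord _ q = q2 q); last by congr (qcoord _ q); exact: val_inj.
  apply: quatP; rewrite !(qE, qD) ?qE; by field.
- apply: (key qk) => q.
  rewrite (_ : qcoord _ q = q3 q); last by congr (qcoord _ q); exact: val_inj.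
  apply: quatP; rewrite !(qE, qD) ?qE; by field.
Qed.

Lemma multinom_split n (a : multinom n) : a != mnm0 ->
  exists i b, a = mnm_add (mnm1 i) b.
Proof.
move=> a0; have [i ai] : exists i, (0 < a i)%N.
  apply: contrapT => /forallNP h; move/eqP: a0; apply; apply/mnmP => i.
  by rewrite mnm0E; apply/eqP; rewrite -leqn0 leqNgt; apply/negP.
exists i, (mnm_sub a (mnm1 i)); apply/mnmP => j.
rewrite mnmDE mnmBE mnm1E addnC subnK//.
by case: eqP => // <-.
Qed.

(** One imaginary coordinate times an axial factor needs no letter; each further coordinate is split
    off on the left and costs one letter through [Hpoly_finM]. Thus degree [k.+1] takes [k]
    letters. *)
Lemma Hpoly_fin_monomial k a p : (mdeg a <= k.+1)%N ->
  Hpoly_fin k (fun q : H => qreal (imag_monomial a q * axial_fun p q)).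
Proof.
have [->|] := eqVneq a (mnm0 : multinom 3).
  move=> _; apply: (@Hpoly_fin_widen 0) => //.
  under eq_fun do rewrite imag_monomial0 mul1r.
  exact: Hpoly_fin0_axial.
elim: k a => [|k IHk] a /multinom_split[i [b ->]]; rewrite mdegD mdeg1 add1n ltnS.
  rewrite leqn0 mdeg_eq0 => /eqP ->.
  under eq_fun do rewrite imag_monomialD imag_monomial0 mulr1 imag_monomial1 mulrC.
  exact: Hpoly_fin0_axial_coord.
move=> bk.
under eq_fun do rewrite imag_monomialD imag_monomial1 -mulrA qrealM.
apply: Hpoly_finM.
  have := Hpoly_fin0_axial_coord i 1.
  by under eq_fun do rewrite /axial_fun meval1 mul1r.
have [b0|b0] := eqVneq b (mnm0 : multinom 3); last exact: IHk.
rewrite b0; apply: (@Hpoly_fin_widen 0) => //.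
under eq_fun do rewrite imag_monomial0 mul1r.
exact: Hpoly_fin0_axial.
Qed.

Theorem Epoly_Hpoly k (f : H -> R) : Epoly k f -> Hpoly k (fun q => qreal (f q)).
Proof.
have aux d : axial_degree_le d.+1 f -> Hpoly_fin d (fun q => qreal (f q)).
  elim => [a p ad|f1 f2 _ IH1 _ IH2]; first exact: Hpoly_fin_monomial.
  by under eq_fun do rewrite qrealD; exact: HspanD.
case: k => [k /Epoly_someP/aux//|/Epoly_noneP[d fd]].
by exists d => //; apply: aux; exact: axial_degree_le_widen fd.
Qed.

End HPolynomials.

(** * The quaternionic moment problem *)

Section Functional.
Context {R : realType}.
Local Notation H := (quat R).

Lemma HpolyD k (f g : H -> H) : Hpoly k f -> Hpoly k g ->
  Hpoly k (fun q => f q + g q).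
Proof.
case: k => [k|]; first exact: HspanD.
move=> [i _ fi] [j _ gj]; exists (maxn i j) => //; apply: HspanD.
  by apply: Hpoly_fin_widen fi; exact: leq_maxl.
by apply: Hpoly_fin_widen gj; exact: leq_maxr.
Qed.

Lemma HpolyM k (a b : H) (f : H -> H) : Hpoly k f -> Hpoly k (fun q => a * f q * b).
Proof.
case: k => [k|]; first exact: HspanM.
by move=> [i _ fi]; exists i => //; exact: HspanM.
Qed.

Lemma qnnegP (p : H) :
  qnneg p <-> [/\ 0 <= q0 p, q1 p = 0, q2 p = 0 & q3 p = 0].
Proof.
split=> [[a a0 ->]|[p0 p1 p2 p3]]; first by rewrite !qE.
by exists (q0 p) => //; apply: quatP; rewrite !qE.
Qed.

Lemma compact_qnorm2_le (K : set H) (r : R) : closed K ->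
  compact (K `&` [set q | qnorm2 q <= r] : set 'rV[R]_4).
Proof.
move=> cK.
have cN : closed ([set q | qnorm2 q <= r] : set 'rV[R]_4).
  have cq : continuous (@qnorm2 R : 'rV[R]_4 -> R).
    have [p pE] := @qnorm2_axial R 1.
    have := Epoly_continuous (Epoly_axial None (p - 1)).
    rewrite (_ : axial_fun _ = @qnorm2 R)//; apply/funext => q.
    by rewrite /axial_fun mevalB meval1 -/(axial_fun p q) pE expr1 addrAC subrr add0r.
  apply: (@preimage_closed 'rV[R]_4 R (@qnorm2 R) [set x | x <= r]).
    by move=> x _; exact: cq.
  exact: closed_le.
have cB : compact [set v : 'rV[R]_4 | forall i, `[- (1 + r), 1 + r]%classic (v ord0 i)].
  apply: (@rV_compact R 4 (fun=> `[- (1 + r), 1 + r]%classic)) => i.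
  exact: segment_compact.
have cKN : closed (K `&` [set q | qnorm2 q <= r] : set 'rV[R]_4).
  by apply: (@closedI 'rV[R]_4 K) => //; exact: cK.
apply: (subclosed_compact cKN cB).
move=> q [_ /= qr] i; rewrite /= in_itv/= -ler_norml.
have := @qcoord_sqr_le R i q.
rewrite -real_normK ?num_real// -/(qcoord i q) => /le_trans/(_ qr).
move: `|qcoord i q| => x xr; have := sqr_ge0 (x - 1); have := sqr_ge0 x.
by rewrite sqrrB1; lra.
Qed.

Variables (k : option nat) (K : set H) (L : (H -> H) -> H).
Hypothesis cK : closed K.
Hypothesis linL : Hlinear_on (Hpoly k) L.
Let Lr (f : H -> R) := L (fun q => qreal (f q)).

Lemma L_add (F G : H -> H) : Hpoly k F -> Hpoly k G ->
  L (fun q => F q + G q) = L F + L G.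
Proof.
move=> PF PG; have := linL PF PG 1 1 1 1; rewrite !mul1r !mulr1 => <-.
by congr L; apply/funext => q; rewrite !mul1r !mulr1.
Qed.

Lemma L_mulr (F : H -> H) (b : H) : Hpoly k F -> L (fun q => F q * b) = L F * b.
Proof.
move=> PF; have := linL PF PF 1 b 0 0; rewrite !mul0r addr0 mul1r => <-.
by congr L; apply/funext => q; rewrite !mul0r addr0 mul1r.
Qed.

Lemma Lr_add f g : Epoly k f -> Epoly k g -> Lr (f + g) = Lr f + Lr g.
Proof.
move=> Ef Eg; rewrite -L_add; [|exact: Epoly_Hpoly..].
by congr L; apply/funext => q; rewrite -qrealD.
Qed.

Lemma Lr_scale (c : R) f : Epoly k f -> Lr (c *: f) = qreal c * Lr f.
Proof.
move=> Ef; rewrite qreal_comm -L_mulr; last exact: Epoly_Hpoly.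
by congr L; apply/funext => q; rewrite -qreal_comm -qrealM.
Qed.

(** If [f] grows like the [m]-th power of 1 + |q|^2, the next power dominates it and makes the
    quotient tend to 0 at infinity. *)
Lemma Epoly_adapted f : Epoly k f -> exists2 g, Epoly k g &
  (forall x, K x -> `|f x| <= g x) /\
  forall e : R, 0 < e -> exists n : nat, forall x, K x ->
    ~ (K `&` [set q | qnorm2 q <= n%:R]) x -> `|f x| <= e * g x.
Proof.
move=> /Epoly_growth[C [m [C0 fC]]]; have [p pE] := @qnorm2_axial R m.+1.
exists (C *: axial_fun p); first exact/EpolyZ/Epoly_axial.
have gE x : (C *: axial_fun p) x = C * (1 + qnorm2 x) ^+ m.+1.
  by rewrite -[LHS]/(C * axial_fun p x) pE.
have N0 x := @qnorm2_ge0 R x.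
have X0 (x : H) : 0 <= (1 + qnorm2 x) ^+ m.
  by apply/exprn_ge0/addr_ge0; [exact: ler01|exact: N0].
split=> [x _|e e0].
  rewrite gE (le_trans (fC x))// ler_wpM2l// exprS ler_peMl//.
  by rewrite lerDl.
(* Outside this set |x|^2 exceeds [e^-1], so the extra factor [e * (1 + qnorm2 x)] is at least 1. *)
exists (Num.truncn e^-1).+1 => x Kx xn.
have eN : 1 <= e * (1 + qnorm2 x).
  rewrite -ler_pdivrMl// mulr1 (le_trans (ltW (truncnS_gt _)))//.
  rewrite ler_wpDl//; apply/ltW; rewrite ltNge; apply/negP => h.
  by apply: xn; split.
by rewrite gE (le_trans (fC x))// exprS mulrCA ler_wpM2l// mulrA ler_peMl.
Qed.

(** Positivity speaks only of polynomials nonnegative on [K]; an arbitrary [f] is [g - (g - f)] with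
    [g] dominating it, and [L] is real on both terms. *)
Lemma Lr_imag f : K_positive k K L -> Epoly k f ->
  [/\ q1 (Lr f) = 0, q2 (Lr f) = 0 & q3 (Lr f) = 0].
Proof.
move=> Lpos Ef; have [g Eg [fg _]] := Epoly_adapted Ef.
have Egf : Epoly k (g - f) by rewrite -scaleN1r; apply/EpolyD/EpolyZ.
have /Lpos/qnnegP[_ g1 g2 g3] : Epos k K g.
  by split => // x Kx; apply: le_trans (fg x Kx).
have /Lpos/qnnegP[_ h1 h2 h3] : Epos k K (g - f).
  split => // x Kx; rewrite -[leRHS]/(g x - f x) subr_ge0.
  by rewrite (le_trans (ler_norm _))// fg.
have := Lr_add Ef Egf; rewrite addrC subrK => E.
rewrite -/(Lr _) E in g1 g2 g3.
by split; [move: g1|move: g2|move: g3]; rewrite qD ?h1 ?h2 ?h3 addr0.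
Qed.

Lemma K_positive_weakly : K_positive k K L -> weakly_K_positive k K L.
Proof.
move=> Lpos f Ef; exists (cst 0).
  split => //; have := EpolyZ 0 Ef.1; rewrite scale0r; exact.
move=> e e0; under eq_fun do rewrite mulr0 addr0; exact: Lpos.
Qed.

Lemma weakly_K_positive_K_positive : weakly_K_positive k K L -> K_positive k K L.
Proof.
move=> Lw f Ef; have [h Eh fh] := Lw _ Ef.
have [[Ef1 _] [Eh1 _]] := (Ef, Eh).
have fhE e : Lr (f + e *: h) = Lr f + qreal e * Lr h.
  by rewrite Lr_add ?Lr_scale//; exact: EpolyZ.
have key e : 0 < e -> [/\ 0 <= q0 (Lr f) + e * q0 (Lr h),
    q1 (Lr f) + e * q1 (Lr h) = 0, q2 (Lr f) + e * q2 (Lr h) = 0 &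
    q3 (Lr f) + e * q3 (Lr h) = 0].
  move=> e0; have /qnnegP := fh e e0.
  rewrite -[L _]/(Lr (f + e *: h)) fhE !(qD, qE).
  by rewrite !mul0r !subr0 !addr0.
apply/qnnegP; rewrite -/(Lr f).
(* An imaginary coordinate is affine in the parameter; vanishing at 1 and at 2, it vanishes at 0.
   The real coordinate is treated by letting the parameter tend to 0. *)
have [_ a1 a2 a3] := key 1 ltr01; have [_ b1 b2 b3] := key 2 (ltr0n R 2).
split; [|lra..].
have h0 e : 0 < e -> 0 <= q0 (Lr f) + e * q0 (Lr h) by move=> /key[].
apply/ler_addgt0Pl => e e0.
have d0 : 0 < e / (`|q0 (Lr h)| + 1) by rewrite divr_gt0// ltr_wpDl.
rewrite (le_trans (h0 _ d0))// addrC lerD2r mulrAC ler_pdivrMr ?ltr_wpDl//.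
by rewrite ler_pM2l// (le_trans (ler_norm _))// lerDl.
Qed.

End Functional.

Lemma quat_hausdorff (R : realType) : hausdorff_space (quat R).
Proof. exact: (@norm_hausdorff R 'rV[R]_4). Qed.

Lemma quat_compact_measurable (R : realType) (C : set (quat R)) :
  compact C -> measurable C.
Proof.
move=> cC; rewrite -[C]setCK; apply: measurableC; apply: sub_sigma_algebra.
by apply: closed_openC; apply: compact_closed => //; exact: quat_hausdorff.
Qed.

(** * Moment functionals and positivity *)

Section Moment.
Context {R : realType}.
Local Notation H := (quat R).
Variables (k : option nat) (K : set H) (L : (H -> H) -> H).
Hypothesis cK : closed K.
Hypothesis linL : Hlinear_on (Hpoly k) L.
Let Lr (f : H -> R) := L (fun q => qreal (f q)).

(** Write [F] as the sum of its coordinates times 1, i, j, k. Right linearity pulls the basis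
    elements out, and the remaining values are real, so no coordinates mix. The moment formula thus
    splits into four real ones. *)
Lemma K_positive_L_coord (F : H -> H) i : K_positive k K L -> Hpoly k F ->
  qcoord i (L F) = q0 (Lr (fun q => qcoord i (F q))).
Proof.
move=> Lpos HF.
have EF j := Hpoly_coord_Epoly j HF.
have HE j (b : H) : Hpoly k (fun q => qreal (qcoord j (F q)) * b).
  by have := HpolyM 1 b (Epoly_Hpoly (EF j)); under eq_fun do rewrite mul1r.
have LE j : Lr (fun q => qcoord j (F q)) = qreal (q0 (Lr (fun q => qcoord j (F q)))).
  have [h1 h2 h3] := Lr_imag linL Lpos (EF j).
  by apply: quatP; rewrite !qE.
pose j0 := @Ordinal 4 0 isT; pose j1 := @Ordinal 4 1 isT.
pose j2 := @Ordinal 4 2 isT; pose j3 := @Ordinal 4 3 isT.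
have -> : L F = Lr (fun q => qcoord j0 (F q)) * 1 +
    Lr (fun q => qcoord j1 (F q)) * qi + Lr (fun q => qcoord j2 (F q)) * qj + Lr (fun q => qcoord j3 (F q)) * qk.
  have LM j (b : H) : Lr (fun q => qcoord j (F q)) * b =
      L (fun q => qreal (qcoord j (F q)) * b).
    by rewrite (L_mulr linL)//; exact: Epoly_Hpoly.
  rewrite !LM -(L_add linL)// -(L_add linL)//; last exact: HpolyD.
  rewrite -(L_add linL)//; last by apply: HpolyD => //; exact: HpolyD.
  by congr L; apply/funext => q; rewrite [LHS]quat_basis.
rewrite (LE j0) (LE j1) (LE j2) (LE j3).
case: i => -[|[|[|[|//]]]] hi.
- rewrite (_ : Ordinal hi = j0); last exact: val_inj.
  by rewrite -[LHS]/(q0 _) !(qD, qE); ring.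
- rewrite (_ : Ordinal hi = j1); last exact: val_inj.
  by rewrite -[LHS]/(q1 _) !(qD, qE); ring.
- rewrite (_ : Ordinal hi = j2); last exact: val_inj.
  by rewrite -[LHS]/(q2 _) !(qD, qE); ring.
- rewrite (_ : Ordinal hi = j3); last exact: val_inj.
  by rewrite -[LHS]/(q3 _) !(qD, qE); ring.
Qed.

Lemma K_positive_moment : K_positive k K L -> K_moment_functional k K L.
Proof.
move=> Lpos.
pose D (n : nat) := K `&` [set q | qnorm2 q <= n%:R].
have E1 : Epoly k (cst 1 : H -> R).
  have := @Epoly_axial R k 1; rewrite (_ : axial_fun 1 = cst 1)//.
  by apply/funext => q; rewrite /axial_fun meval1.
have Dincr n : D n `<=` D n.+1.
  by move=> x [Kx xn]; split => //=; rewrite (le_trans xn)// ler_nat.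
have DK n : D n `<=` K by move=> x [].
have q0L (f : H -> R) : Epoly k f -> (forall x, K x -> 0 <= f x) -> 0 <= q0 (Lr f).
  by move=> Ef f0; have /qnnegP[] : qnneg (Lr f) by apply: Lpos; split.
have LD f g : Epoly k f -> Epoly k g -> q0 (Lr (f + g)) = q0 (Lr f) + q0 (Lr g).
  by move=> Ef Eg; rewrite /Lr (Lr_add linL)// q0D.
have LZ (c : R) f : Epoly k f -> q0 (Lr (c *: f)) = c * q0 (Lr f).
  by move=> Ef; rewrite /Lr (Lr_scale linL)// !qE !mul0r !subr0.
have [mu [mu_fin mu_reg mu_null muE]] := @adapted_representation R
  ('rV[R]_4 : normedModType R)
  K D (Epoly k) (fun f => q0 (Lr f)) (@norm_hausdorff _ _)
  (fun n => compact_qnorm2_le (r := n%:R) cK) Dincr DK E1 (@EpolyD _ k) (@EpolyZ _ k)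
  LD LZ q0L (@Epoly_continuous _ k) (@Epoly_adapted _ k K).
(* [quat R] has the topology of the row vectors and its Borel sets by definition, so the measure
   transfers by conversion. *)
exists (mu : {measure set H -> \bar R}).
split.
- split=> [C cC|A mA].
    apply: le_lt_trans mu_fin; apply: le_measure; rewrite ?inE//.
    exact: quat_compact_measurable.
  apply/eqP; rewrite eq_le; apply/andP; split.
    apply/lee_addgt0Pr => e e0; have [C [cC CA muAC]] := mu_reg A e mA e0.
    apply: le_trans muAC _; apply: leeD => //.
    by apply: ereal_sup_ubound; exists C.
  apply: ge_ereal_sup => _ [C [cC CA] <-].
  by apply: le_measure; rewrite ?inE//; exact: quat_compact_measurable.
- move=> x xsupp; apply: contrapT => nKx.
  have oK : open (~` K) by exact: closed_openC.
  have := xsupp _ oK nKx; rewrite mu_null ?ltxx//; last by rewrite setICl.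
  exact: sub_sigma_algebra.
- move=> F HF; have EF i := Hpoly_coord_Epoly i HF.
  split=> [i|]; first exact: (muE _ (EF i)).1.
  apply/rowP => i; rewrite [RHS]mxE -[LHS]/(qcoord i (L F)).
  rewrite K_positive_L_coord//.
  by rewrite /Rintegral (muE _ (EF i)).2.
Qed.

(** The point is that the complement of [K] is null. By inner regularity it suffices to look at its
    compact subsets, and each of them is covered by finitely many null open sets, since no point off
    [K] is in the support. *)
Lemma moment_K_positive : K_moment_functional k K L -> K_positive k K L.
Proof.
move=> [mu [[mu_fin mu_reg] mu_supp muE]] f [Ef f0].
have mK : measurable (~` K) by apply: sub_sigma_algebra; exact: closed_openC.
have muK : mu (~` K) = 0%E.
  apply/eqP; rewrite eq_le measure_ge0 andbT mu_reg//.
  apply: ge_ereal_sup => _ [C [cC CK] <-].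
  have mC := quat_compact_measurable cC.
  move: cC; rewrite compact_cover => cC.
  pose N := [set U : set H | open U /\ mu U = 0%E].
  have [U [oU _] //|x Cx|N' N'N CN'] := cC (set H) N id.
    have /existsNP[U /not_implyP[oU /not_implyP[Ux muU]]] :
      ~ measure_supp mu x by move=> /mu_supp; exact: CK.
    exists U => //; split => //; apply/eqP; rewrite eq_le measure_ge0 andbT.
    by rewrite leNgt; apply/negP.
  have [mV muV] : measurable (\bigcup_(U in [set` N']) U) /\
      mu (\bigcup_(U in [set` N']) U) = 0%E.
    rewrite bigcup_fset big_seq.
    apply: (big_ind (fun A : set H => measurable A /\ mu A = 0%E)).
    - by split; [exact: measurable0|exact: measure0].
    - move=> A B [mA A0] [mB B0]; split; first exact: measurableU.
      apply/eqP; rewrite eq_le measure_ge0 andbT.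
      by rewrite -[leRHS]adde0 -{1}A0 -B0 measureU2.
    - move=> U /N'N; rewrite inE => -[oU U0]; split => //.
      exact: sub_sigma_algebra.
  by rewrite -muV; apply: le_measure; rewrite ?inE.
have [fint ->] := muE _ (Epoly_Hpoly Ef).
have imag0 (i : 'I_4) : (forall q : H, qcoord i (qreal (f q)) = 0) ->
    qcoord i (qintegral mu (fun q => qreal (f q))) = 0.
  move=> fi; rewrite /qcoord mxE /Rintegral.
  by under eq_integral do rewrite fi; rewrite integral0.
apply/qnnegP; split; [|by apply: imag0 => q; rewrite -[LHS]/(q1 _) qE
  |by apply: imag0 => q; rewrite -[LHS]/(q2 _) qE
  |by apply: imag0 => q; rewrite -[LHS]/(q3 _) qE].
rewrite /q0 /qcoord mxE; apply: fine_ge0.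
have /integrableP[mf _] := fint (@Ordinal 4 0 isT).
(* [f] is nonnegative on [K] only, but it agrees almost everywhere with its absolute value. *)
rewrite (ae_eq_integral
  (abse \o (fun q => (qcoord (@Ordinal 4 0 isT) (qreal (f q)))%:E)))//.
- by apply: integral_ge0 => q _; exact: abse_ge0.
- exact: measurableT_comp.
- exists (~` K); split => // q /= qf Kq; apply: qf => _.
  by rewrite ger0_norm// -[leRHS]/(q0 _) qE; exact: f0.
Qed.

End Moment.

Theorem theorem6p2 (R : realType) (k : option nat) (K : set (quat R))
    (L : (quat R -> quat R) -> quat R) :
  closed K ->
  Hlinear_on (Hpoly k) L ->
  (K_positive k K L <-> weakly_K_positive k K L) /\
  (weakly_K_positive k K L <-> K_moment_functional k K L).
Proof.
move=> cK linL; split; split.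
- exact: K_positive_weakly.
- exact: weakly_K_positive_K_positive.
- by move=> /(weakly_K_positive_K_positive linL); exact: K_positive_moment.
- by move=> /(moment_K_positive cK); exact: K_positive_weakly.
Qed.
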